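(* Let $n\geq 3$ and let $N$ be an $(n+1)$-dimensional Riemannian manifold whose sectional curvature $K_N$ satisfies $K_N\leq K\leq 0$, where $K\leq 0$ is a constant. Let $M$ be a complete minimal hypersurface in $N$, with second fundamental form $A$. Assume that $$\int_M|A|^n\leq\left(\frac{1}{C_s}\right)^{\frac n2},$$ where $C_s$ is the Hoffman--Spruck Sobolev constant. Then $M$ is stable.
   Context: Conventions: $M$ is an oriented $n$-dimensional manifold immersed in the oriented Riemannian manifold $N$, with the induced metric; $|A|$ is the length of its second fundamental form. Minimal means that the mean curvature vanishes identically. Stability: a minimal hypersurface $M$ in $N$ is stable if for every compactly supported Lipschitz function $f$ on $M$, $$\int_M |\nabla f|^2-\bigl(\overline{\mathrm{Ric}}(e_{n+1})+|A|^2\bigr)f^2\geq 0,$$ where $\overline{\mathrm{Ric}}(e_{n+1})$ is the Ricci curvature of $N$ in the direction of the unit normal $e_{n+1}$ of $M$. Sobolev constant: $C_s>0$ is the constant, depending only on $n\geq 3$, in the Hoffman--Spruck Sobolev inequality for a complete immersed minimal submanifold $M^n$ of a nonpositively curved manifold: for every $\phi\in W_0^{1,2}(M)$, $$\left(\int_M|\phi|^{\frac{2n}{n-2}}\,dv\right)^{\frac{n-2}{n}}\leq C_s\int_M|\nabla\phi|^2\,dv.$$ *)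

(* Defs.v *)
From HB Require Import structures.
From mathcomp Require Import all_boot all_order all_algebra.
From mathcomp Require Import all_classical all_reals all_analysis.

Set Implicit Arguments.
Unset Strict Implicit.
Unset Printing Implicit Defensive.

Import Order.TTheory GRing.Theory Num.Theory.
Import numFieldNormedType.Exports.

Local Open Scope classical_set_scope.
Local Open Scope ring_scope.

(* Vectors are rows: a tangent vector u is mapped by a differential to
   u *m 'J F x, where ('J F x) a b is the partial derivative of F_b along
   the a-th coordinate. *)

Section euclidean.
Context {R : realType}.

Definition partial n (i : 'I_n) (f : 'rV[R]_n -> R) : 'rV[R]_n -> R :=
  fun x => 'D_(delta_mx 0 i) f x.

(* C^infinity on an open set D: iterated partial derivatives of all orders
   exist on D and are (Frechet) differentiable there. *)
Definition smooth_on n (D : set 'rV[R]_n) (f : 'rV[R]_n -> R) :=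
  forall (s : seq 'I_n) x, D x -> differentiable (foldr (@partial n) f s) x.

Definition smooth_map_on n m (D : set 'rV[R]_n) (F : 'rV[R]_n -> 'rV[R]_m) :=
  forall b, smooth_on D (fun x => F x 0 b).

(* The Lebesgue integral over R^n of a Borel function with values in [0, +oo],
   as an iterated integral (Tonelli). *)
Fixpoint integralRn n : ('rV[R]_n -> \bar R) -> \bar R :=
  match n return ('rV[R]_n -> \bar R) -> \bar R with
  | 0 => fun f => f 0
  | m.+1 => fun f => (\int[lebesgue_measure]_(t in [set: R])
      integralRn (fun v : 'rV[R]_m => f (row_mx (t%:M : 'M[R]_1) v)))%E
  end.

End euclidean.

Section metric_tensor.
Context {R : realType} {n : nat}.
Variable g : 'rV[R]_n -> 'M[R]_n.

(* Gamma^k_ij *)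
Definition christoffel (k i j : 'I_n) (x : 'rV[R]_n) : R :=
  2^-1 * \sum_(l < n) invmx (g x) k l *
    (partial i (fun y => g y j l) x + partial j (fun y => g y i l) x
     - partial l (fun y => g y i j) x).

(* l-th component of R(d_i, d_j) d_k, where
   R(X, Y) Z = D_X D_Y Z - D_Y D_X Z - D_[X, Y] Z *)
Definition riemann (l i j k : 'I_n) (x : 'rV[R]_n) : R :=
  partial i (christoffel l j k) x - partial j (christoffel l i k) x
  + \sum_(m < n) (christoffel l i m x * christoffel m j k x
                  - christoffel l j m x * christoffel m i k x).

Definition curvature (x u v w : 'rV[R]_n) : 'rV[R]_n :=
  \row_l \sum_(i < n) \sum_(j < n) \sum_(k < n)
    riemann l i j k x * u 0 i * v 0 j * w 0 k.

End metric_tensor.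

(* An oriented Riemannian n-manifold, given by an atlas of positively oriented
   charts and the components of the metric in each chart.  Following the usual
   convention for formal manifolds, every point p comes with a preferred chart
   [chart_at p] around it; tangent vectors at p are represented by their
   components in that chart.  The scalars and vectors defined below are
   independent of this choice, since all the formulas are tensorial.
   The values of [coord i] outside [dom i], and of [param i] and [metric i]
   outside the image of [coord i], are irrelevant. *)
Record orientedRiemannian (R : realType) (n : nat) := OrientedRiemannian {
  space :> ptopologicalType;
  chart : Type;
  dom : chart -> set space;
  coord : chart -> space -> 'rV[R]_n;
  param : chart -> 'rV[R]_n -> space;
  chart_at : space -> chart;
  metric : chart -> 'rV[R]_n -> 'M[R]_n;
  space_hausdorff : hausdorff_space space;
  space_second_countable : @second_countable space;
  dom_chart_at : forall p, dom (chart_at p) p;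
  dom_open : forall i, open (dom i);
  image_open : forall i, open (coord i @` dom i);
  coordK : forall i p, dom i p -> param i (coord i p) = p;
  coord_continuous : forall i, {within dom i, continuous (coord i)};
  param_continuous : forall i,
    {within coord i @` dom i, continuous (param i)};
  transition_smooth : forall i j,
    smooth_map_on (coord i @` (dom i `&` dom j)) (coord j \o param i);
  transition_oriented : forall i j p, dom i p -> dom j p ->
    0 < \det ('J (coord j \o param i) (coord i p));
  metric_smooth : forall i a b,
    smooth_on (coord i @` dom i) (fun x => metric i x a b);
  metric_sym : forall i p, dom i p ->
    (metric i (coord i p))^T = metric i (coord i p);
  metric_posdef : forall i p, dom i p -> forall u : 'rV[R]_n, u != 0 ->
    0 < (u *m metric i (coord i p) *m u^T) 0 0;
  metric_compat : forall i j p, dom i p -> dom j p ->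
    let J := 'J (coord j \o param i) (coord i p) in
    metric i (coord i p) = J *m metric j (coord j p) *m J^T
}.

Section riemannian.
Context {R : realType} {n : nat}.
Variable M : orientedRiemannian R n.
Implicit Types (p q : M) (u v : 'rV[R]_n) (f phi : M -> R)
  (X : M -> 'rV[R]_n).

Definition pcoord p : 'rV[R]_n := coord (chart_at p) p.

Definition gram p : 'M[R]_n := metric (chart_at p) (pcoord p).

Definition inner p u v : R := (u *m gram p *m v^T) 0 0.

Definition sectional p u v : R :=
  inner p (curvature (metric (chart_at p)) (pcoord p) u v v) u
  / (inner p u u * inner p v v - inner p u v ^+ 2).

Definition sectional_le (K : R) := forall p u v,
  row_free (col_mx u v) -> sectional p u v <= K.

(* Ric(v, v), the trace of u |-> R(u, v) v *)
Definition ricci p v : R :=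
  \sum_(i < n)
    curvature (metric (chart_at p)) (pcoord p) (delta_mx 0 i) v v 0 i.

Definition C1_curve (c : R -> M) := continuous c /\
  forall i t, dom i (c t) ->
    derivable (coord i \o c) t 1 /\
    {for t, continuous (derive1 (coord i \o c))}.

Definition speed (c : R -> M) (t : R) : R :=
  let v := derive1 (coord (chart_at (c t)) \o c) t in Num.sqrt (inner (c t) v v).

Definition curve_length (c : R -> M) : \bar R :=
  (\int[lebesgue_measure]_(t in `[0%R, 1%R]) (speed c t)%:E)%E.

(* +oo between different components.  C^1 curves may stop, so that piecewise
   C^1 curves give the same infimum. *)
Definition rdist p q : \bar R :=
  ereal_inf [set curve_length c | c in
    [set c : R -> M | [/\ C1_curve c, c 0 = p & c 1 = q]]].

Definition complete_manifold := forall s : nat -> M,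
  (forall e : R, 0 < e -> exists k0, forall k l,
     (k0 <= k)%N -> (k0 <= l)%N -> (rdist (s k) (s l) < e%:E)%E) ->
  exists p, s @ \oo --> p.

Definition lipschitz f := exists2 L : R, 0 < L &
  forall p q, (`|f p - f q|%:E <= L%:E * rdist p q)%E.

Definition compactly_supported f := compact (closure [set p | f p != 0]).

(* The gradient, with value 0 where f is not differentiable (a null set for f
   Lipschitz, by Rademacher's theorem). *)
Definition grad f p : 'rV[R]_n :=
  let h := f \o param (chart_at p) in
  if `[< differentiable h (pcoord p) >]
  then (\row_a partial a h (pcoord p)) *m invmx (gram p)
  else 0.

Definition borel := g_sigma_algebraType (@open M).

(* dv is the Riemannian measure, sqrt(det g) dx in each chart; this determines
   dv, as M is second countable. *)
Definition is_volume (dv : {measure set borel -> \bar R}) :=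
  forall (i : chart M) (B : set borel), measurable B -> B `<=` dom i ->
    dv B = integralRn (fun x =>
      if x \in coord i @` B then (Num.sqrt (\det (metric i x)))%:E else 0%E).

Definition measurable_field X := forall (i : chart M) (a : 'I_n),
  measurable_fun (dom i : set borel)
    (fun p => (X p *m 'J (coord i \o param (chart_at p)) (pcoord p)) 0 a).

(* phi belongs to W_0^{1,2}, with gradient X: the closure in the W^{1,2} norm
   of the compactly supported Lipschitz functions. *)
Definition W012 (dv : {measure set borel -> \bar R}) phi X :=
  [/\ measurable_fun [set: borel] phi, measurable_field X &
    exists f : nat -> M -> R,
    [/\ forall k, lipschitz (f k) /\ compactly_supported (f k),
        (fun k => \int[dv]_p ((f k p - phi p) ^+ 2)%:E)%E @ \oo --> 0%E &
        (fun k => \int[dv]_p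
          (inner p (grad (f k) p - X p) (grad (f k) p - X p))%:E)%E
        @ \oo --> 0%E]].

(* The Hoffman-Spruck inequality holds on M with the constant Cs. *)
Definition sobolev_constant (dv : {measure set borel -> \bar R}) (Cs : R) :=
  forall phi X, W012 dv phi X ->
    ((\int[dv]_p (`|phi p| `^ (2 * n%:R / (n%:R - 2)))%:E)
       `^ ((n%:R - 2) / n%:R)
     <= Cs%:E * \int[dv]_p (inner p (X p) (X p))%:E)%E.

End riemannian.

Section immersion.
Context {R : realType} {n m : nat}.
Variables (M : orientedRiemannian R n) (N : orientedRiemannian R m).
Variable psi : M -> N.

(* psi in the preferred charts at p and psi p *)
Definition local_map (p : M) : 'rV[R]_n -> 'rV[R]_m :=
  coord (chart_at (psi p)) \o psi \o param (chart_at p).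

Definition Jmap (p : M) : 'M[R]_(n, m) := 'J (local_map p) (pcoord p).

Definition smooth := continuous psi /\
  forall (i : chart M) (j : chart N),
    smooth_map_on (coord i @` (dom i `&` psi @^-1` dom j))
      (coord j \o psi \o param i).

(* psi is an immersion and M carries the induced metric; injectivity of the
   differential follows since the metric of M is positive definite. *)
Definition isometric_immersion := smooth /\
  forall p, gram p = Jmap p *m gram (psi p) *m (Jmap p)^T.

(* Components A(d_a, d_b) of the (normal-valued) second fundamental form
   A(X, Y) = Dbar_X Y - D_X Y. *)
Definition second_ff (p : M) (a b : 'I_n) : 'rV[R]_m :=
  let x := pcoord p in
  let F c := fun y => local_map p y 0 c in
  \row_c (partial a (partial b (F c)) x
    + \sum_(d < m) \sum_(e < m)
        christoffel (metric (chart_at (psi p))) c d e (pcoord (psi p))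
        * partial a (F d) x * partial b (F e) x
    - \sum_(k < n)
        christoffel (metric (chart_at p)) k a b x * partial k (F c) x).

Definition mean_curvature (p : M) : 'rV[R]_m :=
  \sum_(a < n) \sum_(b < n) invmx (gram p) a b *: second_ff p a b.

Definition minimal := forall p, mean_curvature p = 0.

Definition normA (p : M) : R := Num.sqrt
  (\sum_(a < n) \sum_(b < n) \sum_(c < n) \sum_(d < n)
    invmx (gram p) a c * invmx (gram p) b d
    * inner (psi p) (second_ff p a b) (second_ff p c d)).

End immersion.

Section hypersurface.
Context {R : realType} {n : nat}.
Variables (M : orientedRiemannian R n) (N : orientedRiemannian R (n + 1)).
Variable psi : M -> N.

Definition is_unit_normal (p : M) (nu : 'rV[R]_(n + 1)) :=
  [/\ Jmap psi p *m gram (psi p) *m nu^T = 0,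
      inner (psi p) nu nu = 1 &
      0 < \det (col_mx (Jmap psi p) nu)].

Definition unit_normal (p : M) : 'rV[R]_(n + 1) := xget 0 (is_unit_normal p).

Definition stable (dv : {measure set (borel M) -> \bar R}) :=
  forall f : M -> R, lipschitz f -> compactly_supported f ->
    (0 <= \int[dv]_p
       (inner p (grad f p) (grad f p)
        - (ricci (psi p) (unit_normal p) + normA psi p ^+ 2) * f p ^+ 2)%:E)%E.

End hypersurface.

(* Main.v *)
From HB Require Import structures.
From mathcomp Require Import all_boot all_order all_algebra.
From mathcomp Require Import all_classical all_reals all_analysis.
From mathcomp Require Import measurable_realfun.
From mathcomp Require Import ring lra.
Require Import Defs.

Set Implicit Arguments.
Unset Strict Implicit.
Unset Printing Implicit Defensive.

Import Order.TTheory GRing.Theory Num.Theory.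
Import numFieldNormedType.Exports.

Local Open Scope classical_set_scope.
Local Open Scope ring_scope.

(** A hypersurface with small total curvature is stable because the Sobolev
inequality, fed with the test function itself, already controls the curvature
term of the second variation.  Let [f] be Lipschitz with compact support.
Hoelder's inequality with the conjugate exponents [n/2] and [n/(n-2)] gives

  int |A|^2 f^2 <= (int |A|^n)^(2/n) (int |f|^(2n/(n-2)))^((n-2)/n),

whose first factor is at most [1/Cs] by assumption, and whose second factor is
at most [Cs int |grad f|^2] by the Sobolev inequality; hence
[int |A|^2 f^2 <= int |grad f|^2].  The Ricci term has the favourable sign: the
Ricci curvature is the trace of the Jacobi operator [u |-> R(u, nu) nu], and
this operator is negative semidefinite when the sectional curvatures are
nonpositive ([ricci_le0]).

Integrals being defined for every function, the analytic content lies in the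
regularity that makes the two displayed inequalities meaningful.

- [|A|] has to be measurable ([normA_continuous]).  It is computed at each point
  in charts that may vary wildly with the point, so one needs that [|A|] does
  not depend on the charts.  This rests on the transformation law of the
  Christoffel symbols ([chrow_change]): a change of coordinates is an isometry
  of the coordinate domains and has vanishing second fundamental form.
- [f] has to be continuous ([lipschitz_continuous]): the Riemannian distance is
  locally bounded by a multiple of the coordinate distance, as is seen on the
  coordinate segments.
- [f] has to belong to [W_0^{1,2}] with gradient [grad f]
  ([lipschitz_W012]).  The constant sequence [f] approximates [f], so
  the point is the measurability of [grad f], that is of the set of points of
  differentiability of a continuous function and of its partial derivatives
  there ([differentiable_set_measurable], [partial_measurable]).
- [int |A|^2 f^2] has to be finite, so that the difference of the two integrals
  makes sense; this follows from Hoelder's inequality since [f] is bounded and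
  its support has finite volume ([compact_finite_volume]).

Only the sign of the Ricci term enters: it increases the positive part and
decreases the negative part of the integrand, and the integral is monotone on all
nonnegative functions, measurable or not ([ge0_le_integral_raw],
[integral_ge0_of_le]). *)

(** * Positive definite matrices and traces *)

Section algebra.
Context {R : realType}.

Definition posdef n (G : 'M[R]_n) :=
  forall u : 'rV[R]_n, u != 0 -> 0 < (u *m G *m u^T) 0 0.

Lemma posdef_unit n (G : 'M[R]_n) : posdef G -> G \in unitmx.
Proof.
move=> pG; rewrite -row_free_unit -kermx_eq0; apply/eqP/row_matrixP => i.
rewrite row0; apply/eqP/negPn/negP => /pG.
have -> : row i (kermx G) *m G = 0.
  by apply/sub_kermxP; exact: row_sub.
by rewrite mul0mx mxE ltxx.
Qed.

(** A basis orthonormal for [G] is built one vector at a time: the Schur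
    complement of the first entry is again positive definite. *)
Lemma posdef_cholesky n (G : 'M[R]_n) : G^T = G -> posdef G ->
  exists P : 'M[R]_n, P *m G *m P^T = 1%:M.
Proof.
elim: n G => [|n IHn] G.
  by exists 0; apply/matrixP => -[].
suff gen (G' : 'M[R]_(1 + n)) : G'^T = G' -> posdef G' ->
    exists P : 'M[R]_(1 + n), P *m G' *m P^T = 1%:M by exact: gen.
move=> symG' posG'.
pose a : R := G' 0 0; pose b : 'rV[R]_n := ursubmx G'; pose D := drsubmx G'.
have GE : G' = block_mx a%:M b b^T D.
  rewrite -[LHS]submxK; congr block_mx.
    by rewrite [LHS]mx11_scalar !mxE !lshift0.
  by rewrite /b trmx_ursub symG'.
have symD : D^T = D by rewrite /D trmx_drsub symG'.
have a0 : 0 < a.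
  have e0 : row_mx 1%:M 0 != 0 :> 'rV[R]_(1 + n).
    apply/eqP => /matrixP /(_ 0 (lshift n 0)).
    by rewrite row_mxEl !mxE eqxx => /eqP; rewrite oner_eq0.
  have := posG' _ e0; rewrite GE mul_row_block tr_row_mx mul_row_col.
  by rewrite !mul1mx !mul0mx !addr0 trmx1 trmx0 mulmx0 addr0 mulmx1 mxE.
pose S := D - a^-1 *: (b^T *m b).
have key (u : 'rV[R]_n) (w := row_mx (- (a^-1 *: (u *m b^T))) u : 'rV_(1 + n)) :
    w *m G' = row_mx 0 (u *m S).
  rewrite /w GE mul_row_block mulNmx -scalemxAl mul_mx_scalar scalerA.
  rewrite mulVf ?gt_eqF// scale1r addNr mulNmx /S mulmxBr -scalemxAl.
  by rewrite -scalemxAr mulmxA addrC.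
have symS : S^T = S.
  by rewrite /S linearB linearZ /= trmx_mul trmxK symD.
have posS : posdef S.
  move=> u u0; pose w : 'rV_(1 + n) := row_mx (- (a^-1 *: (u *m b^T))) u.
  have w0 : w != 0.
    by apply: contra u0 => /eqP /(congr1 rsubmx); rewrite row_mxKr => ->; rewrite linear0.
  have := posG' _ w0; rewrite key tr_row_mx mul_row_col mul0mx add0r.
  by [].
have [P PS] := IHn _ symS posS.
pose s := (Num.sqrt a)^-1.
pose Q : 'M[R]_(1 + n) := block_mx s%:M 0 (- (a^-1 *: (P *m b^T))) P.
exists Q; rewrite GE /Q.
rewrite (@tr_block_mx _ 1 n 1 n) !mulmx_block.
have sE : s * a * s = 1.
  by rewrite /s -{2}[a]sqr_sqrtr ?ltW// expr2; field; rewrite gt_eqF// sqrtr_gt0.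
rewrite !mulNmx !mul0mx !addr0 -!scalemxAl !mul_mx_scalar scalerA mulVf ?gt_eqF//.
rewrite scale1r addNr trmx0 !mul0mx add0r !mulmx0 !addr0 ?add0r tr_scalar_mx.
rewrite scale_scalar_mx !mul_scalar_mx scale_scalar_mx.
have -> : - (a^-1 *: (P *m b^T *m b)) + P *m D = P *m S.
  by rewrite /S mulmxBr -scalemxAr mulmxA addrC.
have -> : (a * s) *: (- (a^-1 *: (P *m b^T)))^T + s *: b *m P^T = 0.
  rewrite linearN linearZ /= trmx_mul trmxK scalerN scalerA -scalemxAl.
  by rewrite mulrAC mulfV ?gt_eqF// mul1r addNr.
by rewrite PS (mulrC a) sE -scalar_mx_block.
Qed.

(** Writing the trace in an orthonormal basis of the inner product [G]. *)
Lemma trace_le0 n (G T : 'M[R]_n) : G^T = G -> posdef G ->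
  (forall u : 'rV[R]_n, (u *m T *m G *m u^T) 0 0 <= 0) -> \tr T <= 0.
Proof.
move=> symG posG TG; have [P PG] := posdef_cholesky symG posG.
have -> : \tr T = \tr (P *m T *m (G *m P^T)).
  have GPT : G *m P^T *m P = 1%:M by apply: mulmx1C; rewrite mulmxA.
  by rewrite [RHS]mxtrace_mulC mulmxA GPT mul1mx.
apply: sumr_le0 => i _; apply: le_trans (TG (row i P)).
rewrite -!row_mul mulmxA [leLHS]mxE [leRHS]mxE le_eqVlt; apply/orP; left.
by apply/eqP; rewrite [RHS]mxE; apply: eq_bigr => k _; rewrite !mxE.
Qed.

End algebra.

(** * Sign of the Ricci curvature *)

Section ricci_sign.
Context {R : realType} {n : nat} (N : orientedRiemannian R n).
Implicit Types (p : N) (u v w : 'rV[R]_n).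

Lemma gram_sym p : (gram p)^T = gram p.
Proof. exact/metric_sym/dom_chart_at. Qed.

Lemma gram_posdef p : posdef (gram p).
Proof. by move=> u; apply/metric_posdef/dom_chart_at. Qed.

Lemma innerC p u v : inner p u v = inner p v u.
Proof.
rewrite /inner; have -> : u *m gram p *m v^T = (v *m gram p *m u^T)^T.
  by rewrite !trmx_mul trmxK gram_sym mulmxA.
by rewrite mxE.
Qed.

Lemma inner_addZl p (a : R) u v w : inner p (u + a *: v) w = inner p u w + a * inner p v w.
Proof. by rewrite /inner !mulmxDl -!scalemxAl !mxE. Qed.

Lemma inner_addZr p (a : R) u v w : inner p w (u + a *: v) = inner p w u + a * inner p w v.
Proof. by rewrite innerC inner_addZl !(innerC p w). Qed.

Lemma inner_ge0 p u : 0 <= inner p u u.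
Proof.
have [->|u0] := eqVneq u 0; first by rewrite /inner !mul0mx mxE.
exact/ltW/gram_posdef.
Qed.

(** The matrix of [u |-> R(u, v) v], acting on rows. *)
Definition jacobi_mx p v : 'M[R]_n := \matrix_(i, l)
  \sum_(j < n) \sum_(k < n) riemann (metric (chart_at p)) l i j k (pcoord p) * v 0 j * v 0 k.

Lemma curvature_jacobi p u v :
  curvature (metric (chart_at p)) (pcoord p) u v v = u *m jacobi_mx p v.
Proof.
apply/rowP => l; rewrite !mxE; apply: eq_bigr => i _; rewrite mxE big_distrr /=.
apply: eq_bigr => j _; rewrite big_distrr /=; apply: eq_bigr => k _.
by rewrite -!mulrA; ring.
Qed.

(** [R(v, v) v = 0] by antisymmetry; this settles the vectors [u] parallel to
    [v], on which the sectional curvature says nothing. *)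
Lemma jacobi_self p v : v *m jacobi_mx p v = 0.
Proof.
have anti l i j k x : riemann (metric (chart_at p)) l i j k x
    = - riemann (metric (chart_at p)) l j i k x.
  rewrite /riemann opprD opprB -sumrN; congr (_ + _).
  by apply: eq_bigr => m _; rewrite opprB.
apply/rowP => l; rewrite -curvature_jacobi !mxE.
set s := LHS; suff : s = - s by lra.
rewrite {1}/s exchange_big /= /s -sumrN; apply: eq_bigr => i _.
rewrite -sumrN; apply: eq_bigr => j _; rewrite -sumrN; apply: eq_bigr => k _.
by rewrite anti; ring.
Qed.

(** Nonpositive sectional curvature makes the Jacobi operator negative
    semidefinite; its trace is the Ricci curvature. *)
Lemma ricci_le0 (K : R) p v : K <= 0 -> sectional_le N K -> ricci p v <= 0.
Proof.
move=> K0 secK; have -> : ricci p v = \tr (jacobi_mx p v).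
  apply: eq_bigr => i _; rewrite curvature_jacobi mxE (bigD1 i)//= big1 => [|j ji].
    by rewrite mxE !eqxx mul1r addr0.
  by rewrite mxE (negbTE ji) andbF mul0r.
apply: (trace_le0 (gram_sym p) (@gram_posdef p)) => u.
rewrite -/(inner p (u *m jacobi_mx p v) u).
have [v0|v0] := eqVneq v 0.
  suff -> : jacobi_mx p v = 0 by rewrite mulmx0 /inner !mul0mx mxE.
  apply/matrixP => i l; rewrite !mxE big1// => j _; rewrite big1// => k _.
  by rewrite v0 !mxE mulr0.
have vv : 0 < inner p v v by exact: gram_posdef.
pose c := inner p u v / inner p v v; pose w := u + (- c) *: v.
(* [w] is the component of [u] orthogonal to [v]: the sectional curvature is
   defined exactly when it does not vanish. *)
have [w0|w0] := eqVneq w 0.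
  have -> : u = c *: v by apply/eqP; rewrite -subr_eq0 -scaleNr -/w w0.
  by rewrite -scalemxAl jacobi_self scaler0 /inner !mul0mx mxE.
have ww : 0 < inner p w w by exact: gram_posdef.
have den : inner p u u * inner p v v - inner p u v ^+ 2 = inner p w w * inner p v v.
  rewrite /w !inner_addZl !inner_addZr (innerC p v u) /c.
  by field; rewrite gt_eqF.
have free : row_free (col_mx u v).
  apply: inj_row_free => z; rewrite -[z]hsubmxK mul_row_col.
  rewrite (mx11_scalar (lsubmx z)) (mx11_scalar (rsubmx z)) !mul_scalar_mx.
  set a := lsubmx z 0 0; set b := rsubmx z 0 0 => ab0.
  have a0 : a = 0.
    apply/eqP/negPn/negP => a0; move/negP: w0; apply.
    have ub : u = (- (b / a)) *: v.
      apply/eqP; rewrite -subr_eq0 scaleNr opprK -(inj_eq (scalerI a0)) scaler0.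
      by rewrite scalerDr scalerA mulrCA mulfV// mulr1 ab0.
    have bc : c = - (b / a).
      rewrite /c ub -[X in inner p X v]add0r inner_addZl.
      by rewrite {1}/inner !mul0mx mxE add0r mulfK// gt_eqF.
    by rewrite /w bc {1}ub scaleNr opprK addNr.
  move: ab0; rewrite a0 scale0r add0r => /eqP; rewrite scaler_eq0 (negbTE v0) orbF.
  by move=> /eqP ->; rewrite !raddf0 row_mx0.
have := secK p u v free; rewrite /sectional den curvature_jacobi => /le_trans /(_ K0).
by rewrite pmulr_lle0// invr_gt0 mulr_gt0.
Qed.

End ricci_sign.

(** * Differential calculus in coordinates *)

Section calculus.
Context {R : realType}.
Implicit Types (m n : nat).

Lemma partialE n (f : 'rV[R]_n -> R) x i : differentiable f x ->
  partial i f x = 'd f x (delta_mx 0 i).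
Proof. by move=> df; rewrite /partial deriveE. Qed.

Lemma diff_partials n (f : 'rV[R]_n -> R) x v : differentiable f x ->
  'd f x v = \sum_i v 0 i * partial i f x.
Proof.
move=> df; rewrite {1}(row_sum_delta v) linear_sum /=.
by apply: eq_bigr => i _; rewrite linearZ /= partialE.
Qed.

Lemma differentiable_rV (V : normedModType R) n (F : V -> 'rV[R]_n) x :
  (forall b, differentiable (fun y => F y 0 b) x) -> differentiable F x.
Proof.
move=> dF; have -> : F = \sum_(b < n) (fun y => F y 0 b *: delta_mx 0 b).
  by apply/funext => y; rewrite fct_sumE -row_sum_delta.
apply: differentiable_sum => b.
exact: (@differentiableZl _ _ _ (fun y => F y 0 b)).
Qed.

Lemma differentiable_rV_coord (V : normedModType R) n (F : V -> 'rV[R]_n) x b :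
  differentiable F x -> differentiable (fun y => F y 0 b) x.
Proof.
move=> dF; apply: (@differentiable_comp _ _ _ _ F (fun v : 'rV[R]_n => v 0 b)) => //.
exact: differentiable_coord.
Qed.

Lemma jacobianE m n (F : 'rV[R]_m -> 'rV[R]_n) x a b : differentiable F x ->
  'J F x a b = partial a (fun y => F y 0 b) x.
Proof.
move=> dF; rewrite /jacobian mxE -deriveE// derive_mx ?mxE//.
exact: diff_derivable.
Qed.

Lemma partial_comp m n (F : 'rV[R]_m -> 'rV[R]_n) (h : 'rV[R]_n -> R) x a :
  differentiable F x -> differentiable h (F x) ->
  partial a (h \o F) x =
  \sum_b partial a (fun y => F y 0 b) x * partial b h (F x).
Proof.
move=> dF dh; have dhF : differentiable (h \o F) x by exact: differentiable_comp.
rewrite (partialE _ dhF) (diff_comp dF dh) -[LHS]/('d h (F x) ('d F x (delta_mx 0 a))).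
rewrite (diff_partials _ dh); apply: eq_bigr => b _; congr (_ * _).
by rewrite -(jacobianE _ _ dF) mxE.
Qed.

Lemma near_eq_partial n (f g : 'rV[R]_n -> R) x i :
  (\near x, f x = g x) -> partial i f x = partial i g x.
Proof. exact: near_eq_derive. Qed.

Lemma open_eq_partial n (D : set 'rV[R]_n) (f g : 'rV[R]_n -> R) x i :
  open D -> D x -> (forall y, D y -> f y = g y) -> partial i f x = partial i g x.
Proof.
move=> oD Dx fg; apply: near_eq_partial.
by near=> y; apply: fg; near: y; exact: open_nbhs_nbhs.
Unshelve. all: by end_near. Qed.


(** Differentiability with explicit epsilons, usable without Landau notation. *)
Lemma differentiable_eps (V W : normedModType R) (f : V -> W) x :
  differentiable f x -> forall e, 0 < e ->
  \forall h \near (0 : V), `|f (h + x) - f x - 'd f x h| <= e * `|h|.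
Proof.
move=> /diff_locallyP[_ /eqaddoP fo] e e0.
have := fo e e0; apply: filterS => h /=.
by rewrite -[(_ - _) h]/(f (h + x) - (f x + 'd f x h)) opprD addrA.
Qed.

Lemma eps_differentiable (V W : normedModType R) (f : V -> W) (df : {linear V -> W}) x :
  continuous df ->
  (forall e, 0 < e -> \forall h \near (0 : V), `|f (h + x) - f x - df h| <= e * `|h|) ->
  differentiable f x /\ 'd f x = df :> (V -> W).
Proof.
move=> cdf fe.
have fo : f \o shift x = cst (f x) + df +o_ (0 : V) id.
  apply/eqaddoP => e e0; have := fe e e0; apply: filterS => h /=.
  by rewrite -[(_ - _) h]/(f (h + x) - (f x + df h)) opprD addrA.
have dE := diff_unique cdf fo; split=> //.
by apply/diff_locallyP; split; rewrite dE.
Qed.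

Lemma near_eq_differentiable (V W : normedModType R) (f g : V -> W) x :
  (\near x, f x = g x) -> differentiable f x -> differentiable g x.
Proof.
move=> fg df; have fx : f x = g x by exact: (nbhs_singleton fg).
suff [] : differentiable g x /\ 'd g x = 'd f x :> (V -> W) by [].
apply: eps_differentiable => [|e e0]; first exact: diff_continuous.
have fg0 : \forall h \near (0 : V), f (h + x) = g (h + x).
  have cs : (fun h : V => h + x) @ (0 : V) --> x.
    rewrite -{2}[x]add0r.
    by apply: cvgD; [exact: cvg_id|exact: cvg_cst].
  exact: cs fg.
have := differentiable_eps df e0.
by apply: filterS2 fg0 => h <-; rewrite -fx.
Qed.

Lemma partialD n (f g : 'rV[R]_n -> R) x i :
  differentiable f x -> differentiable g x ->
  partial i (fun y => f y + g y) x = partial i f x + partial i g x.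
Proof. by move=> df dg; rewrite /partial deriveD//; exact: diff_derivable. Qed.

Lemma partialM n (f g : 'rV[R]_n -> R) x i :
  differentiable f x -> differentiable g x ->
  partial i (fun y => f y * g y) x = partial i f x * g x + f x * partial i g x.
Proof.
move=> df dg; rewrite /partial deriveM; try exact: diff_derivable.
by rewrite addrC mulrC [X in X + _]mulrC.
Qed.

Lemma differentiable_sum_seq (V : normedModType R) (I : Type) (r : seq I)
    (f : I -> V -> R) x :
  (forall k, differentiable (f k) x) ->
  differentiable (fun y => \sum_(k <- r) f k y) x.
Proof.
move=> df; elim: r => [|k r IHr].
  under eq_fun do rewrite big_nil.
  exact: differentiable_cst.
under eq_fun do rewrite big_cons.
exact: (@differentiableD _ _ _ (f k)).
Qed.

Lemma partial_sum n (I : Type) (r : seq I) (f : I -> 'rV[R]_n -> R) x i :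
  (forall k, differentiable (f k) x) ->
  partial i (fun y => \sum_(k <- r) f k y) x = \sum_(k <- r) partial i (f k) x.
Proof.
move=> df; elim: r => [|k r IHr].
  under eq_fun do rewrite big_nil.
  by rewrite big_nil /partial derive_cst.
under eq_fun do rewrite big_cons.
by rewrite big_cons partialD ?IHr//; exact: differentiable_sum_seq.
Qed.

Lemma differentiable_mul (V : normedModType R) (f g : V -> R) x :
  differentiable f x -> differentiable g x -> differentiable (fun y => f y * g y) x.
Proof. exact: differentiableM. Qed.

End calculus.

Section smoothness.
Context {R : realType} {n : nat}.
Implicit Types (D : set 'rV[R]_n) (f : 'rV[R]_n -> R).

Lemma smooth_differentiable D f x : smooth_on D f -> D x -> differentiable f x.
Proof. by move=> sf; exact: (sf [::]). Qed.

Lemma smooth_partial D f i : smooth_on D f -> smooth_on D (partial i f).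
Proof. by move=> sf s x Dx; have := sf (rcons s i) x Dx; rewrite foldr_rcons. Qed.

Lemma smooth_map_differentiable m D (F : 'rV[R]_n -> 'rV[R]_m) x :
  smooth_map_on D F -> D x -> differentiable F x.
Proof.
by move=> sF Dx; apply: differentiable_rV => b; exact: smooth_differentiable (sF b) Dx.
Qed.

Lemma line_derive (V : normedModType R) (g : V -> R) (y e : V) (t : R) :
  differentiable g (t *: e + y) ->
  is_derive t 1 (fun u : R => g (u *: e + y)) ('D_e g (t *: e + y)).
Proof.
move=> dg; have gd : derivable g (t *: e + y) e by exact: diff_derivable.
have E : (fun h : R => h^-1 *: (g ((h *: 1 + t) *: e + y) - g (t *: e + y)))
       = (fun h : R => h^-1 *: (g (h *: e + (t *: e + y)) - g (t *: e + y))).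
  by apply/funext => h; rewrite [h%:A]mulr1 scalerDl addrA.
by apply: DeriveDef; [rewrite /derivable E|rewrite /derive E].
Qed.

Lemma shift_differentiable (V W : normedModType R) (h : V -> W) v y :
  differentiable h (v + y) -> differentiable (fun y => h (v + y)) y.
Proof.
by move=> dh; apply: (@differentiable_comp _ _ _ _ (fun y => v + y) h).
Qed.

Lemma shift_derive (V W : normedModType R) (h : V -> W) v y e :
  'D_e (fun y => h (v + y)) y = 'D_e h (v + y).
Proof.
have E : (fun r : R => r^-1 *: (h (v + (r *: e + y)) - h (v + y)))
       = (fun r : R => r^-1 *: (h (r *: e + (v + y)) - h (v + y))).
  by apply/funext => r; rewrite addrCA.
by rewrite /derive E.
Qed.

Lemma mean_value_line (V : normedModType R) (g : V -> R) (y e : V) (s : R) : 0 < s ->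
  (forall t, 0 <= t <= s -> differentiable g (t *: e + y)) ->
  exists2 t, 0 < t < s & g (s *: e + y) - g y = s * 'D_e g (t *: e + y).
Proof.
move=> s0 dg; have dphi t : 0 <= t <= s ->
    is_derive t 1 (fun u : R => g (u *: e + y)) ('D_e g (t *: e + y)).
  by move=> /dg; exact: line_derive.
have [t| |t] := @MVT R (fun u : R => g (u *: e + y)) (fun t => 'D_e g (t *: e + y)) 0 s s0.
- by rewrite in_itv /= => /andP[t0 ts]; apply: dphi; rewrite !ltW.
- apply: derivable_within_continuous => t ts.
  by have [] := dphi t; first by move: ts; rewrite in_itv.
- rewrite in_itv /= => ts; rewrite scale0r add0r subr0 mulrC => E.
  by exists t.
Qed.

(** Schwarz's theorem.  The second difference of [f] over a square of side [u]
    equals [u ^+ 2] times a mixed second derivative at some point of the square,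
    in either order of derivation; let [u] tend to [0]. *)
Lemma partial_sym D f x i j : open D -> D x -> smooth_on D f ->
  partial i (partial j f) x = partial j (partial i f) x.
Proof.
move=> oD Dx sf; wlog suff key : i j /
    forall r, 0 < r -> exists2 s, 0 < s & forall u, 0 < u < s -> exists2 y,
      `|x - y| < r & 
      f (u *: delta_mx 0 i + (u *: delta_mx 0 j + x)) - f (u *: delta_mx 0 i + x)
        - (f (u *: delta_mx 0 j + x) - f x) = u * (u * partial i (partial j f) y).
  apply/eqP; rewrite -subr_eq0 -normr_le0; apply/ler_addgt0Pl => e e0.
  rewrite addr0; have e20 : 0 < e / 2 by rewrite divr_gt0.
  have cont k l : \forall y \near x, `|partial k (partial l f) x - partial k (partial l f) y| < e / 2.
    have : {for x, continuous (partial k (partial l f))}.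
      by apply/differentiable_continuous/(smooth_differentiable _ Dx)/smooth_partial/smooth_partial.
    by move=> /cvgrPdist_lt; exact.
  have swap (a b c d : R) : a - b - (c - d) = a - c - (b - d) by ring.
  have /nbhs_normP[r1 /= r10 h1] := cont i j.
  have /nbhs_normP[r2 /= r20 h2] := cont j i.
  have [s1 s10 k1] := key i j _ r10; have [s2 s20 k2] := key j i _ r20.
  pose u := Num.min s1 s2 / 2.
  have m0 : 0 < Num.min s1 s2 by rewrite lt_min s10.
  have u0 : 0 < u by rewrite divr_gt0.
  have um : u < Num.min s1 s2 by rewrite /u; lra.
  have [|y1 y1r E1] := k1 u; first by rewrite u0 (lt_le_trans um)// ge_min lexx.
  have [|y2 y2r E2] := k2 u; first by rewrite u0 (lt_le_trans um)// ge_min lexx orbT.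
  have E : partial i (partial j f) y1 = partial j (partial i f) y2.
    apply: (mulfI (lt0r_neq0 u0)); apply: (mulfI (lt0r_neq0 u0)).
    refine (etrans (esym E1) (etrans _ E2)).
    by rewrite (addrCA (u *: delta_mx 0 j)) swap.
  rewrite (splitr e) -(subrK (partial i (partial j f) y1) (partial i _ x)) -addrA.
  apply: le_trans (ler_normD _ _) _; apply: lerD; first exact/ltW/h1.
  by rewrite E distrC; exact/ltW/h2.
have swap (a b c d : R) : a - b - (c - d) = a - c - (b - d) by ring.
move=> r r0; have /nbhs_normP[r' /= r'0 hD] : nbhs x D by exact: open_nbhs_nbhs.
set ei := delta_mx 0 i : 'rV[R]_n; set ej := delta_mx 0 j : 'rV[R]_n.
pose C := `|ei| + `|ej| + 1.
have C0 : 0 < C by rewrite ltr_wpDl// addr_ge0.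
pose s := Num.min r r' / C.
have m0 : 0 < Num.min r r' by rewrite lt_min r0.
exists s; first by rewrite divr_gt0.
move=> u /andP[u0 us].
have close a b : 0 <= a <= u -> 0 <= b <= u ->
    `|x - (a *: ei + (b *: ej + x))| < Num.min r r'.
  move=> /andP[a0 au] /andP[b0 bu].
  rewrite opprD addrCA opprD [x + _]addrC addrNK -opprD normrN.
  apply: (@le_lt_trans _ _ (u * C)); last by rewrite -ltr_pdivlMr.
  apply: le_trans (ler_normD _ _) _; rewrite !normrZ !ger0_norm// /C !mulrDr.
  by rewrite mulr1 -[X in X <= _]addr0; apply: lerD; [apply: lerD; exact: ler_wpM2r|exact: ltW].
have inD a b : 0 <= a <= u -> 0 <= b <= u -> D (a *: ei + (b *: ej + x)).
  by move=> au bu; apply: hD; apply: lt_le_trans (close _ _ au bu) _; rewrite ge_min lexx orbT.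
have uu : 0 <= u <= u by rewrite ltW/=.
have zu : 0 <= (0 : R) <= u by rewrite lexx ltW.
pose g y := f (u *: ei + y) - f y.
have dg t : 0 <= t <= u -> differentiable g (t *: ej + x).
  move=> tu; have Dt := inD u t uu tu; have D0 := inD 0 t zu tu.
  rewrite scale0r add0r in D0.
  apply: (@differentiableB _ _ _ (fun y => f (u *: ei + y))).
    exact/shift_differentiable/(smooth_differentiable sf).
  exact: smooth_differentiable sf _.
have [t /andP[t0 tu] gt] := mean_value_line u0 dg.
have {}tu : 0 <= t <= u by rewrite !ltW.
have Dt := inD u t uu tu; have D0 := inD 0 t zu tu; rewrite scale0r add0r in D0.
have gt' : 'D_ej g (t *: ej + x) =
    partial j f (u *: ei + (t *: ej + x)) - partial j f (t *: ej + x).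
  rewrite deriveB.
  - by rewrite shift_derive.
  - exact/diff_derivable/shift_differentiable/(smooth_differentiable sf).
  - exact/diff_derivable/(smooth_differentiable sf).
have dp v : 0 <= v <= u -> differentiable (partial j f) (v *: ei + (t *: ej + x)).
  by move=> vu; apply: smooth_differentiable (smooth_partial j sf) _; exact: inD.
have [v /andP[v0 vu] pv] := mean_value_line u0 dp.
have {}vu : 0 <= v <= u by rewrite !ltW.
exists (v *: ei + (t *: ej + x)).
  by apply: lt_le_trans (close _ _ vu tu) _; rewrite ge_min lexx.
by rewrite -[partial i _ _]/('D_ei _ _) -pv -gt' -gt /g swap.
Qed.

End smoothness.

(** * The second fundamental form under changes of coordinates *)

Section second_order.
Context {R : realType}.

Notation comp F c := (fun y => F y 0 c).

Lemma partial2_comp m n (D : set 'rV[R]_m) (D' : set 'rV[R]_n)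
    (F : 'rV[R]_m -> 'rV[R]_n) (h : 'rV[R]_n -> R) x a b :
  open D -> D x -> (forall y, D y -> D' (F y)) -> smooth_map_on D F -> smooth_on D' h ->
  partial a (partial b (h \o F)) x =
    \sum_c partial a (partial b (comp F c)) x * partial c h (F x)
    + \sum_c \sum_d partial b (comp F c) x * partial a (comp F d) x
        * partial d (partial c h) (F x).
Proof.
move=> oD Dx DF sF sh.
have dF y : D y -> differentiable F y by exact: smooth_map_differentiable.
rewrite (@open_eq_partial _ _ D _
  (fun y => \sum_c partial b (comp F c) y * (partial c h \o F) y)) //; last first.
  move=> y Dy; apply: partial_comp; first exact: dF.
  exact: smooth_differentiable sh (DF _ Dy).
have d1 c : differentiable (partial b (comp F c)) x.
  exact: smooth_differentiable (smooth_partial b (sF c)) Dx.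
have d2 c : differentiable (partial c h) (F x).
  exact: smooth_differentiable (smooth_partial c sh) (DF _ Dx).
have d3 c : differentiable (partial c h \o F) x.
  by apply: differentiable_comp; [exact: dF|exact: d2].
rewrite partial_sum => [|c]; last exact: differentiable_mul.
rewrite -big_split; apply: eq_bigr => c _ /=.
rewrite [LHS](partialM _ (d1 c) (d3 c)); congr (_ + _).
rewrite (partial_comp _ (dF _ Dx) (d2 c)) mulr_sumr.
by apply: eq_bigr => d _; rewrite mulrA.
Qed.

(** The matrices [g] and [g'] are components of one metric in two coordinate
    systems, [theta] being the change of coordinates. *)
Record metric_change n (D : set 'rV[R]_n) (g : 'rV[R]_n -> 'M[R]_n)
    (theta : 'rV[R]_n -> 'rV[R]_n) (D' : set 'rV[R]_n) (g' : 'rV[R]_n -> 'M[R]_n) :=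
  MetricChange {
  mc_open : open D;
  mc_maps : forall x, D x -> D' (theta x);
  mc_smooth : smooth_map_on D theta;
  mc_smooth' : forall a b, smooth_on D' (fun y => g' y a b);
  mc_sym : forall y, D' y -> (g' y)^T = g' y;
  mc_unit : forall x, D x -> g x \in unitmx;
  mc_pull : forall x, D x -> g x = 'J theta x *m g' (theta x) *m ('J theta x)^T
}.

(** The Christoffel symbols [Gamma^k_ij] as a row in [k]: the coordinate vector
    field [D_{d_i} d_j]. *)
Definition chrow n (g : 'rV[R]_n -> 'M[R]_n) i j x : 'rV[R]_n :=
  \row_k christoffel g k i j x.

(** The ambient derivative [Dbar_{d_a} dF(d_b)], before the intrinsic part is
    subtracted. *)
Definition hess m n (gN : 'rV[R]_n -> 'M[R]_n) (F : 'rV[R]_m -> 'rV[R]_n) x a b : 'rV[R]_n :=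
  \row_c (partial a (partial b (comp F c)) x
   + \sum_(d < n) \sum_(e < n) christoffel gN c d e (F x)
       * partial a (comp F d) x * partial b (comp F e) x).

Lemma chrow_lower n (g : 'rV[R]_n -> 'M[R]_n) i j x l :
  (g x)^T = g x -> g x \in unitmx ->
  (chrow g i j x *m g x) 0 l = 2^-1 *
    (partial i (fun y => g y j l) x + partial j (fun y => g y i l) x
     - partial l (fun y => g y i j) x).
Proof.
move=> sg ug.
pose k : 'rV[R]_n := \row_l (partial i (fun y => g y j l) x + partial j (fun y => g y i l) x
     - partial l (fun y => g y i j) x).
have -> : chrow g i j x = 2^-1 *: (k *m (invmx (g x))^T).
  apply/rowP => c; rewrite !mxE; congr (_ * _).
  by apply: eq_bigr => d _; rewrite !mxE mulrC.
by rewrite -scalemxAl -mulmxA trmx_inv sg mulVmx// mulmx1 !mxE.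
Qed.

Lemma sum3_rev (I : finType) (f : I -> I -> I -> R) :
  \sum_a \sum_b \sum_c f a b c = \sum_c \sum_b \sum_a f a b c.
Proof.
rewrite exchange_big [RHS]exchange_big; apply: eq_bigr => b _.
exact: exchange_big.
Qed.

Lemma sum4_swap (I J : finType) (f : I -> I -> J -> J -> R) :
  \sum_p \sum_q \sum_r \sum_s f p q r s = \sum_r \sum_s \sum_p \sum_q f p q r s.
Proof.
under eq_bigr do rewrite exchange_big.
rewrite exchange_big /=; apply: eq_bigr => r _.
under eq_bigr do rewrite exchange_big.
by rewrite exchange_big.
Qed.

Lemma sum4_mid (I : finType) (f : I -> I -> I -> I -> R) :
  \sum_a \sum_b \sum_c \sum_d f a b c d = \sum_b \sum_d \sum_a \sum_c f a b c d.
Proof.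
rewrite exchange_big; apply: eq_bigr => b _ /=.
under eq_bigr do rewrite exchange_big.
exact: exchange_big.
Qed.

Section law.
Variables (n : nat) (D D' : set 'rV[R]_n) (g g' : 'rV[R]_n -> 'M[R]_n)
  (theta : 'rV[R]_n -> 'rV[R]_n).
Hypothesis mc : metric_change D g theta D' g'.
Variable x : 'rV[R]_n.
Hypothesis Dx : D x.

Let th a i := partial i (comp theta a) x.
Let S a i j := partial i (partial j (comp theta a)) x.
Let P l i j := \sum_b \sum_a S a l i * g' (theta x) a b * th b j.
Let T l i j := \sum_b \sum_a \sum_c th a i * th b j * th c l
   * partial c (fun y => g' y a b) (theta x).

Lemma mc_diff : differentiable theta x.
Proof. exact: smooth_map_differentiable (mc_smooth mc) Dx. Qed.

Lemma mc_J a i : 'J theta x i a = th a i.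
Proof. by rewrite jacobianE//; exact: mc_diff. Qed.

Lemma mc_gsym y : D y -> (g y)^T = g y.
Proof.
move=> Dy; rewrite (mc_pull mc Dy) !trmx_mul trmxK mulmxA (mc_sym mc)//.
exact: mc_maps mc _ Dy.
Qed.

Lemma mc_Jg_unit : g' (theta x) *m ('J theta x)^T \in unitmx.
Proof.
have := mc_unit mc Dx; rewrite (mc_pull mc Dx) -mulmxA unitmx_mul.
by move=> /andP[].
Qed.

Lemma mc_J_unit : 'J theta x \in unitmx.
Proof.
have := mc_unit mc Dx; rewrite (mc_pull mc Dx) -mulmxA unitmx_mul.
by move=> /andP[].
Qed.

Lemma mc_invmx :
  invmx (g' (theta x)) = ('J theta x)^T *m invmx (g x) *m 'J theta x.
Proof.
have ug : g x \in unitmx by exact: (mc_unit mc Dx).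
have ug' : g' (theta x) \in unitmx.
  by have := mc_Jg_unit; rewrite unitmx_mul => /andP[].
apply: (can_inj (mulmxK ug')); rewrite mulVmx//.
have uJt : ('J theta x)^T \in unitmx by rewrite unitmx_tr mc_J_unit.
have Jg : 'J theta x *m g' (theta x) = g x *m invmx ('J theta x)^T.
  by rewrite (mc_pull mc Dx) mulmxK.
by rewrite -[RHS]mulmxA Jg mulmxA mulmxKV// mulmxV.
Qed.

(** The derivative of [g = J g' J^T]: [P] collects the terms in the second
    derivatives of [theta], [T] those in the derivatives of [g']. *)
Lemma partial_metric l i j : partial l (fun y => g y i j) x = P l i j + P l j i + T l i j.
Proof.
have dth a k y : D y -> differentiable (partial k (comp theta a)) y.
  by move=> Dy; exact: smooth_differentiable (smooth_partial k (mc_smooth mc a)) Dy.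
have dgp a b : differentiable (fun y => g' y a b) (theta x).
  exact: smooth_differentiable (mc_smooth' mc a b) (mc_maps mc Dx).
have dg a b : differentiable (fun y => g' (theta y) a b) x.
  by apply: (@differentiable_comp _ _ _ _ theta (fun y => g' y a b)); [exact: mc_diff|].
rewrite (@open_eq_partial _ _ D _
  (fun y => \sum_b \sum_a partial i (comp theta a) y * g' (theta y) a b
     * partial j (comp theta b) y)) //; first last.
- move=> y Dy; have dt : differentiable theta y.
    exact: smooth_map_differentiable (mc_smooth mc) Dy.
  rewrite (mc_pull mc Dy) mxE; apply: eq_bigr => b _.
  rewrite mxE mulr_suml; apply: eq_bigr => a _.
  by rewrite [('J _ _)^T _ _]mxE !(jacobianE _ _ dt).
- exact: mc_open mc.
have d12 a b : differentiable (fun y => partial i (comp theta a) y * g' (theta y) a b) x.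
  by apply: differentiable_mul; [exact: dth|exact: dg].
have d123 a b : differentiable (fun y => partial i (comp theta a) y
    * g' (theta y) a b * partial j (comp theta b) y) x.
  by apply: differentiable_mul; [exact: d12|exact: dth].
rewrite partial_sum => [|b]; last exact: differentiable_sum_seq.
have gs a b : g' (theta x) a b = g' (theta x) b a.
  by rewrite -{1}(mc_sym mc (mc_maps mc Dx)) mxE.
have -> : P l j i = \sum_b \sum_a th a i * g' (theta x) a b * S b l j.
  rewrite /P exchange_big; apply: eq_bigr => b _; apply: eq_bigr => a _ /=.
  by rewrite gs mulrC mulrA [RHS]mulrAC.
rewrite -!big_split; apply: eq_bigr => b _ /=.
rewrite partial_sum => [|a]; last exact: d123.
rewrite -!big_split; apply: eq_bigr => a _ /=.
rewrite partialM; [|exact: d12|exact: dth].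
rewrite partialM; [|exact: dth|exact: dg].
rewrite [partial l (fun y => g' (theta y) a b) x](partial_comp _ mc_diff (dgp a b)).
rewrite mulrDl mulr_sumr mulr_suml -!addrA; congr (_ + _); rewrite addrC; congr (_ + _).
by apply: eq_bigr => c _; rewrite -/(th _ _) -/(th _ _) -/(th _ _); ring.
Qed.

(** Transformation law of the Christoffel symbols.  After lowering the index by
    the metric this is an identity between Koszul expressions: in the sum of
    three derivatives of the metric, the terms [P] cancel except for one pair,
    by symmetry of the second derivatives. *)
Lemma chrow_change i j : chrow g i j x *m 'J theta x = hess g' theta x i j.
Proof.
apply: (can_inj (mulmxK mc_Jg_unit)).
rewrite -mulmxA [X in _ *m X]mulmxA -(mc_pull mc Dx).
have D'x := mc_maps mc Dx.
have ug' : g' (theta x) \in unitmx by have := mc_Jg_unit; rewrite unitmx_mul => /andP[].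
apply/rowP => l; rewrite chrow_lower; [|exact: mc_gsym|exact: mc_unit mc _ Dx].
rewrite !partial_metric.
have symP a b c : P a b c = P b a c.
  have symS q : S q a b = S q b a.
    exact: partial_sym (mc_open mc) Dx (mc_smooth mc q).
  by rewrite /P; apply: eq_bigr => p _; apply: eq_bigr => q _; rewrite symS.
have -> : hess g' theta x i j = (\row_a S a i j)
   + \sum_a \sum_b (th a i * th b j) *: chrow g' a b (theta x).
  apply/rowP => c; rewrite !mxE summxE; congr (_ + _); apply: eq_bigr => a _.
  rewrite summxE; apply: eq_bigr => b _.
  by rewrite !mxE -mulrA mulrC.
rewrite mulmxDl mxE.
have -> : ((\row_a S a i j) *m (g' (theta x) *m ('J theta x)^T)) 0 l = P i j l.
  rewrite mulmxA mxE; apply: eq_bigr => b _; rewrite mxE mulr_suml.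
  by apply: eq_bigr => a _; rewrite [(\row_a _) _ _]mxE [('J _ _)^T _ _]mxE mc_J.
have -> : (((\sum_a \sum_b (th a i * th b j) *: chrow g' a b (theta x)))
     *m (g' (theta x) *m ('J theta x)^T)) 0 l =
   \sum_a \sum_b \sum_c th a i * th b j * th c l * (2^-1 * (
      partial a (fun y => g' y b c) (theta x) + partial b (fun y => g' y a c) (theta x)
      - partial c (fun y => g' y a b) (theta x))).
  rewrite mulmx_suml summxE; apply: eq_bigr => a _.
  rewrite mulmx_suml summxE; apply: eq_bigr => b _.
  rewrite -scalemxAl mxE mulmxA mxE mulr_sumr; apply: eq_bigr => c _.
  rewrite chrow_lower//; last exact: mc_sym mc _ D'x.
  by rewrite [('J _ _)^T _ _]mxE mc_J; ring.
pose dg a b c := th a i * th b j * th c l * partial a (fun y => g' y b c) (theta x).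
have E1 : T i j l = \sum_a \sum_b \sum_c dg a b c.
  rewrite sum3_rev; apply: eq_bigr => c _; apply: eq_bigr => b _.
  by apply: eq_bigr => a _; rewrite /dg; ring.
pose dg2 a b c := th a i * th b j * th c l * partial b (fun y => g' y a c) (theta x).
have E2 : T j i l = \sum_a \sum_b \sum_c dg2 a b c.
  rewrite sum3_rev; apply: eq_bigr => c _; rewrite exchange_big; apply: eq_bigr => a _.
  by apply: eq_bigr => b _; rewrite /dg2; ring.
pose dg3 a b c := th a i * th b j * th c l * partial c (fun y => g' y a b) (theta x).
have E3 : T l i j = \sum_a \sum_b \sum_c dg3 a b c.
  by rewrite /T exchange_big.
rewrite (symP j i) (symP l i) (symP l j) E1 E2 E3.
have -> : \sum_a \sum_b \sum_c th a i * th b j * th c l * (2^-1 * (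
      partial a (fun y => g' y b c) (theta x) + partial b (fun y => g' y a c) (theta x)
      - partial c (fun y => g' y a b) (theta x))) =
  2^-1 * (\sum_a \sum_b \sum_c dg a b c + \sum_a \sum_b \sum_c dg2 a b c
     - \sum_a \sum_b \sum_c dg3 a b c).
  rewrite -sumrN -!big_split mulr_sumr; apply: eq_bigr => a _ /=.
  rewrite -sumrN -!big_split mulr_sumr; apply: eq_bigr => b _ /=.
  rewrite -sumrN -!big_split mulr_sumr; apply: eq_bigr => c _ /=.
  by rewrite /dg /dg2 /dg3; ring.
have alg (p q r t1 t2 t3 : R) :
    2^-1 * (p + q + t1 + (p + r + t2) - (q + r + t3)) = p + 2^-1 * (t1 + t2 - t3).
  by field.
exact: alg.
Qed.

End law.

(** Second fundamental form in given coordinates; [g] is the metric of the source,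
    [h] that of the target. *)
Definition sff m n (g : 'rV[R]_m -> 'M[R]_m) (h : 'rV[R]_n -> 'M[R]_n)
    (F : 'rV[R]_m -> 'rV[R]_n) x a b : 'rV[R]_n :=
  hess h F x a b - chrow g a b x *m 'J F x.

Definition sff_norm2 m n (g : 'rV[R]_m -> 'M[R]_m) (h : 'rV[R]_n -> 'M[R]_n)
    (F : 'rV[R]_m -> 'rV[R]_n) x : R :=
  \sum_(a < m) \sum_(b < m) \sum_(c < m) \sum_(d < m)
    invmx (g x) a c * invmx (g x) b d
    * (sff g h F x a b *m h (F x) *m (sff g h F x c d)^T) 0 0.

Lemma jacobian_comp k m n (F : 'rV[R]_k -> 'rV[R]_m) (G : 'rV[R]_m -> 'rV[R]_n) x :
  differentiable F x -> differentiable G (F x) ->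
  'J (G \o F) x = 'J F x *m 'J G (F x).
Proof.
move=> dF dG; have dGF : differentiable (G \o F) x by exact: differentiable_comp.
apply/matrixP => a b; rewrite (jacobianE _ _ dGF) [RHS]mxE.
have dGb : differentiable (comp G b) (F x) by exact: differentiable_rV_coord.
rewrite [LHS](partial_comp _ dF dGb); apply: eq_bigr => c _.
by rewrite (jacobianE _ _ dF) (jacobianE _ _ dG).
Qed.

(** The second derivatives of [tau] produced by the chain rule are those that
    appear in the transformation law of the Christoffel symbols of the target. *)
Lemma hess_target m n (D : set 'rV[R]_m) (E E' : set 'rV[R]_n) h h' tau
    (F : 'rV[R]_m -> 'rV[R]_n) x a b :
  open D -> D x -> smooth_map_on D F -> (forall y, D y -> E (F y)) ->
  metric_change E h tau E' h' ->
  hess h' (tau \o F) x a b = hess h F x a b *m 'J tau (F x).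
Proof.
move=> oD Dx sF FE mc; have EF := FE _ Dx.
have dF : differentiable F x by exact: smooth_map_differentiable sF Dx.
have dt : differentiable tau (F x) by exact: (mc_diff mc EF).
have -> : hess h F x a b = (\row_c partial a (partial b (comp F c)) x)
    + \sum_p \sum_q (partial a (comp F p) x * partial b (comp F q) x) *: chrow h p q (F x).
  apply/rowP => c; rewrite [LHS]mxE [RHS]mxE [X in _ = X + _]mxE; congr (_ + _).
  rewrite summxE; apply: eq_bigr => p _; rewrite summxE; apply: eq_bigr => q _.
  by rewrite [RHS]mxE [chrow _ _ _ _ _ _]mxE; ring.
rewrite mulmxDl mulmx_suml.
under eq_bigr do rewrite mulmx_suml.
under eq_bigr do under eq_bigr do rewrite -scalemxAl (chrow_change mc EF).
apply/rowP => c; have dtc : differentiable (comp tau c) (F x).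
  exact: (differentiable_rV_coord c dt).
rewrite [LHS]mxE [RHS]mxE [X in _ = X + _]mxE.
rewrite [X in X + _](partial2_comp _ _ oD Dx FE sF (mc_smooth mc c)) -addrA.
congr (_ + _).
  apply: eq_bigr => d _; rewrite [(\row__ _) _ _]mxE.
  by rewrite (jacobianE _ _ dt).
rewrite summxE; under [RHS]eq_bigr do rewrite summxE.
under [RHS]eq_bigr do under eq_bigr do rewrite !mxE mulrDr.
under [RHS]eq_bigr do rewrite big_split.
rewrite [RHS]big_split; apply: (f_equal2 +%R).
  rewrite [LHS]exchange_big.
  apply: eq_bigr => p _.
  apply: eq_bigr => q _.
  by rewrite [X in X * _ = _]mulrC.
have pt e p : partial e (fun y => (tau \o F) y 0 p) x =
    \sum_d partial e (comp F d) x * partial d (comp tau p) (F x).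
  exact: (partial_comp _ dF (differentiable_rV_coord p dt)).
under [LHS]eq_bigr do under eq_bigr do rewrite !pt.
under [RHS]eq_bigr do under eq_bigr do rewrite mulr_sumr.
under [RHS]eq_bigr do under eq_bigr do under eq_bigr do rewrite mulr_sumr.
rewrite [RHS]sum4_swap; apply: eq_bigr => r _; apply: eq_bigr => s _.
rewrite -mulrA mulr_suml mulr_sumr; apply: eq_bigr => p _.
by rewrite !mulr_sumr; apply: eq_bigr => q _; rewrite -[(tau \o F) x]/(tau (F x)); ring.
Qed.


Lemma sff_norm2_target m n (D : set 'rV[R]_m) (E E' : set 'rV[R]_n) g h h' tau
    (F : 'rV[R]_m -> 'rV[R]_n) x :
  open D -> D x -> smooth_map_on D F -> (forall y, D y -> E (F y)) ->
  metric_change E h tau E' h' ->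
  sff_norm2 g h' (tau \o F) x = sff_norm2 g h F x.
Proof.
move=> oD Dx sF FE mc; have EF := FE _ Dx.
have dF : differentiable F x by exact: smooth_map_differentiable sF Dx.
have dt : differentiable tau (F x) by exact: (mc_diff mc EF).
have sE a b : sff g h' (tau \o F) x a b = sff g h F x a b *m 'J tau (F x).
  rewrite /sff (hess_target a b oD Dx sF FE mc) (jacobian_comp dF dt).
  by rewrite mulmxBl mulmxA.
rewrite /sff_norm2; apply: eq_bigr => a _; apply: eq_bigr => b _.
apply: eq_bigr => c _; apply: eq_bigr => d _.
by rewrite !sE (mc_pull mc EF) trmx_mul !mulmxA.
Qed.

Lemma hess_source m n (D D' : set 'rV[R]_m) g g' theta h
    (F : 'rV[R]_m -> 'rV[R]_n) x a b :
  D x -> metric_change D g theta D' g' -> smooth_map_on D' F ->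
  hess h (F \o theta) x a b =
  (\row_c partial a (partial b (comp theta c)) x) *m 'J F (theta x)
  + \sum_p \sum_q ('J theta x a p * 'J theta x b q) *: hess h F (theta x) p q.
Proof.
move=> Dx mc sF; have D'x := mc_maps mc Dx.
have dF : differentiable F (theta x) by exact: smooth_map_differentiable sF D'x.
have dt : differentiable theta x by exact: (mc_diff mc Dx).
apply/rowP => c; rewrite [LHS]mxE [RHS]mxE [X in _ = X + _]mxE.
rewrite [X in X + _](partial2_comp _ _ (mc_open mc) Dx (mc_maps mc) (mc_smooth mc) (sF c)) -addrA.
apply: (f_equal2 +%R).
  apply: eq_bigr => d _; rewrite [(\row__ _) _ _]mxE.
  by rewrite (jacobianE _ _ dF).
have -> : (\sum_p \sum_q ('J theta x a p * 'J theta x b q) *: hess h F (theta x) p q) 0 c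
  = \sum_p \sum_q ('J theta x a p * 'J theta x b q * partial p (partial q (comp F c)) (theta x)
     + 'J theta x a p * 'J theta x b q * \sum_(d < n) \sum_(e < n)
         christoffel h c d e (F (theta x))
         * partial p (comp F d) (theta x) * partial q (comp F e) (theta x)).
  rewrite summxE; apply: eq_bigr => p _; rewrite summxE; apply: eq_bigr => q _.
  by rewrite [LHS]mxE [hess _ _ _ _ _ _ _]mxE mulrDr.
under [RHS]eq_bigr do rewrite big_split.
rewrite [RHS]big_split; apply: (f_equal2 +%R).
  rewrite [LHS]exchange_big.
  apply: eq_bigr => p _.
  apply: eq_bigr => q _.
  by rewrite !(jacobianE _ _ dt) [X in X * _ = _]mulrC.
have pt e p : partial e (fun y => (F \o theta) y 0 p) x =
    \sum_d 'J theta x e d * partial d (comp F p) (theta x).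
  under eq_bigr do rewrite (jacobianE _ _ dt).
  exact: (partial_comp _ dt (differentiable_rV_coord p dF)).
under [LHS]eq_bigr do under eq_bigr do rewrite !pt.
under [RHS]eq_bigr do under eq_bigr do rewrite mulr_sumr.
under [RHS]eq_bigr do under eq_bigr do under eq_bigr do rewrite mulr_sumr.
rewrite [RHS]sum4_swap; apply: eq_bigr => r _; apply: eq_bigr => s _.
rewrite -mulrA mulr_suml mulr_sumr; apply: eq_bigr => p _.
by rewrite !mulr_sumr; apply: eq_bigr => q _; rewrite -[(F \o theta) x]/(F (theta x)); ring.
Qed.

(** Tensoriality in the source: the second derivatives of [theta] that appear in
    [hess] and in the Christoffel symbols of the source cancel. *)
Lemma sff_source m n (D D' : set 'rV[R]_m) g g' theta h
    (F : 'rV[R]_m -> 'rV[R]_n) x a b :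
  D x -> metric_change D g theta D' g' -> smooth_map_on D' F ->
  sff g h (F \o theta) x a b =
  \sum_p \sum_q ('J theta x a p * 'J theta x b q) *: sff g' h F (theta x) p q.
Proof.
move=> Dx mc sF; have D'x := mc_maps mc Dx.
have dF : differentiable F (theta x) by exact: smooth_map_differentiable sF D'x.
have dt : differentiable theta x by exact: (mc_diff mc Dx).
rewrite /sff (hess_source _ _ _ Dx mc sF) (jacobian_comp dt dF) mulmxA.
rewrite (chrow_change mc Dx) [X in _ - X *m _](_ : _ =
    (\row_c partial a (partial b (comp theta c)) x) +
    \sum_p \sum_q ('J theta x a p * 'J theta x b q) *: chrow g' p q (theta x)).
  rewrite mulmxDl opprD addrACA subrr add0r mulmx_suml -sumrB.
  apply: eq_bigr => p _; rewrite mulmx_suml -sumrB; apply: eq_bigr => q _.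
  by rewrite -scalemxAl -scalerBr.
apply/rowP => c; rewrite [LHS]mxE [RHS]mxE [X in _ = X + _]mxE; apply: (f_equal2 +%R) => //.
rewrite summxE; apply: eq_bigr => p _; rewrite summxE; apply: eq_bigr => q _.
by rewrite [RHS]mxE [chrow _ _ _ _ _ _]mxE !(jacobianE _ _ dt); ring.
Qed.

Lemma sum_congruence k l (G : 'M[R]_k) (J : 'M[R]_(k, l)) (t : 'I_l -> 'I_l -> R) :
  \sum_a \sum_c G a c * (\sum_p \sum_q J a p * J c q * t p q) =
  \sum_p \sum_q (J^T *m G *m J) p q * t p q.
Proof.
under eq_bigr do under eq_bigr do rewrite mulr_sumr.
under eq_bigr do under eq_bigr do under eq_bigr do rewrite mulr_sumr.
rewrite sum4_swap; apply: eq_bigr => p _; apply: eq_bigr => q _.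
rewrite exchange_big mxE mulr_suml; apply: eq_bigr => c _.
rewrite mxE !mulr_suml; apply: eq_bigr => a _.
by rewrite mxE; ring.
Qed.

Lemma sum_congruence2 k (G G' J : 'M[R]_k) (t : 'I_k -> 'I_k -> 'I_k -> 'I_k -> R) :
  G' = J^T *m G *m J ->
  \sum_a \sum_b \sum_c \sum_d G a c * G b d *
    (\sum_p \sum_r J a p * J c r * (\sum_q \sum_s J b q * J d s * t p q r s)) =
  \sum_p \sum_q \sum_r \sum_s G' p r * G' q s * t p q r s.
Proof.
move=> GE; rewrite [LHS]sum4_mid.
transitivity (\sum_b \sum_d G b d * (\sum_a \sum_c G a c *
    (\sum_p \sum_r J a p * J c r * (\sum_q \sum_s J b q * J d s * t p q r s)))).
  apply: eq_bigr => b _; apply: eq_bigr => d _; rewrite mulr_sumr.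
  apply: eq_bigr => a _; rewrite mulr_sumr; apply: eq_bigr => c _.
  by rewrite mulrA [G b d * _]mulrC.
under eq_bigr do under eq_bigr do rewrite sum_congruence -GE.
transitivity (\sum_p \sum_r G' p r * (\sum_b \sum_d G b d *
    (\sum_q \sum_s J b q * J d s * t p q r s))).
  under eq_bigr do under eq_bigr do rewrite mulr_sumr.
  under eq_bigr do under eq_bigr do under eq_bigr do rewrite mulr_sumr.
  rewrite sum4_swap; apply: eq_bigr => p _; apply: eq_bigr => r _.
  rewrite mulr_sumr; apply: eq_bigr => b _; rewrite mulr_sumr.
  by apply: eq_bigr => d _; rewrite mulrCA.
under eq_bigr do under eq_bigr do rewrite sum_congruence -GE.
apply: eq_bigr => p _; rewrite [RHS]exchange_big; apply: eq_bigr => r _ /=.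
rewrite mulr_sumr; apply: eq_bigr => q _; rewrite mulr_sumr; apply: eq_bigr => s _.
by rewrite mulrA.
Qed.

Lemma sff_norm2_source m n (D D' : set 'rV[R]_m) g g' theta h
    (F : 'rV[R]_m -> 'rV[R]_n) x :
  D x -> metric_change D g theta D' g' -> smooth_map_on D' F ->
  sff_norm2 g h (F \o theta) x = sff_norm2 g' h F (theta x).
Proof.
move=> Dx mc sF; have D'x := mc_maps mc Dx.
set J := 'J theta x; set G := invmx (g x).
have gE : invmx (g' (theta x)) = J^T *m G *m J by exact: (mc_invmx mc Dx).
pose t a b c d := (sff g' h F (theta x) a b *m h (F (theta x)) *m (sff g' h F (theta x) c d)^T) 0 0.
have E1 a b c d : (sff g h (F \o theta) x a b *m h ((F \o theta) x)
      *m (sff g h (F \o theta) x c d)^T) 0 0 =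
    \sum_p \sum_r J a p * J c r * (\sum_q \sum_s J b q * J d s * t p q r s).
  transitivity (\sum_p \sum_q \sum_r \sum_s J a p * J c r * (J b q * J d s * t p q r s)).
    rewrite !(sff_source _ _ _ Dx mc sF).
    rewrite !mulmx_suml summxE; apply: eq_bigr => p _.
    rewrite !mulmx_suml summxE; apply: eq_bigr => q _.
    rewrite linear_sum mulmx_sumr summxE; apply: eq_bigr => r _ /=.
    rewrite linear_sum mulmx_sumr summxE; apply: eq_bigr => s _ /=.
    rewrite linearZ /= -!scalemxAl -scalemxAr [LHS]mxE [X in _ * X]mxE -/J.
    by rewrite -/(t p q r s); ring.
  apply: eq_bigr => p _; rewrite exchange_big; apply: eq_bigr => r _ /=.
  rewrite mulr_sumr; apply: eq_bigr => q _.
  by rewrite mulr_sumr.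
rewrite /sff_norm2 -/G.
apply: etrans (sum_congruence2 t gE).
apply: eq_bigr => a _; apply: eq_bigr => b _.
apply: eq_bigr => c _; apply: eq_bigr => d _.
exact: (f_equal (fun z => G a c * G b d * z) (E1 a b c d)).
Qed.

End second_order.

(** * Continuity of |A| *)

Section continuity.
Context {R : realType} {T : topologicalType}.

Lemma near_eq_cont (U : topologicalType) (f g : T -> U) x : (\near x, f x = g x) ->
  {for x, continuous f} -> {for x, continuous g}.
Proof.
move=> fg cf; have fx : f x = g x by exact: (nbhs_singleton fg).
suff : g @ x --> g x by exact.
rewrite -fx; apply: cvg_trans cf; exact: near_eq_cvg.
Qed.

Lemma cont_sum (I : Type) (r : seq I) (P : pred I) (f : I -> T -> R) x :
  (forall i, {for x, continuous (f i)}) ->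
  {for x, continuous (fun y => \sum_(i <- r | P i) f i y)}.
Proof.
move=> fc; elim: r => [|i r IHr].
  have -> : (fun y => \sum_(i <- [::] | P i) f i y) = cst 0.
    by apply/funext => y; rewrite big_nil.
  exact: cst_continuous.
have -> : (fun y => \sum_(i <- i :: r | P i) f i y) =
    (fun y => if P i then f i y + \sum_(i <- r | P i) f i y else \sum_(i <- r | P i) f i y).
  by apply/funext => y; rewrite big_cons.
by case: (P i) => //; apply: cvgD => //; exact: fc.
Qed.

Lemma cont_prod (I : Type) (r : seq I) (P : pred I) (f : I -> T -> R) x :
  (forall i, {for x, continuous (f i)}) ->
  {for x, continuous (fun y => \prod_(i <- r | P i) f i y)}.
Proof.
move=> fc; elim: r => [|i r IHr].
  have -> : (fun y => \prod_(i <- [::] | P i) f i y) = cst 1.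
    by apply/funext => y; rewrite big_nil.
  exact: cst_continuous.
have -> : (fun y => \prod_(i <- i :: r | P i) f i y) =
    (fun y => if P i then f i y * \prod_(i <- r | P i) f i y else \prod_(i <- r | P i) f i y).
  by apply/funext => y; rewrite big_cons.
by case: (P i) => //; apply: cvgM => //; exact: fc.
Qed.

Lemma cont_mul (f g : T -> R) x : {for x, continuous f} -> {for x, continuous g} ->
  {for x, continuous (fun y => f y * g y)}.
Proof. exact: cvgM. Qed.

Lemma cont_add (f g : T -> R) x : {for x, continuous f} -> {for x, continuous g} ->
  {for x, continuous (fun y => f y + g y)}.
Proof. exact: cvgD. Qed.

Lemma cont_opp (f : T -> R) x : {for x, continuous f} ->
  {for x, continuous (fun y => - f y)}.
Proof. exact: cvgN. Qed.

Lemma cont_det n (A : T -> 'M[R]_n) x :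
  (forall i j, {for x, continuous (fun y => A y i j)}) ->
  {for x, continuous (fun y => \det (A y))}.
Proof.
move=> Ac; apply: cont_sum => s; apply: cont_mul; first exact: cst_continuous.
by apply: cont_prod => i; exact: Ac.
Qed.

Lemma cont_invmx n (A : T -> 'M[R]_n) x i j :
  (forall i j, {for x, continuous (fun y => A y i j)}) -> A x \in unitmx ->
  {for x, continuous (fun y => invmx (A y) i j)}.
Proof.
move=> Ac uA; have dA := cont_det Ac.
have dA0 : \det (A x) != 0 by rewrite -unitfE -unitmxE.
have near_unit : \forall y \near x, \det (A y) != 0.
  have /dA // : nbhs (\det (A x)) [set z | z != 0].
  by apply: open_nbhs_nbhs; split=> //; exact: open_neq.
have c2 : {for x, continuous (fun y => (\det (A y))^-1 * cofactor (A y) j i)}.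
  apply: cont_mul; first exact: cvgV.
  rewrite /cofactor; apply: cont_mul; first exact: cst_continuous.
  apply: cont_det => a b.
  have -> : (fun y => row' j (col' i (A y)) a b) = (fun y => A y (lift j a) (lift i b)).
    by apply/funext => y; rewrite !mxE.
  exact: Ac.
apply: near_eq_cont c2; near=> y; rewrite /invmx unitmxE unitfE ifT ?mxE//.
by near: y.
Unshelve. all: by end_near. Qed.

End continuity.

Section charts.
Context {R : realType} {n : nat} (M : orientedRiemannian R n).
Implicit Types (p q : M) (O : set M) (i j : chart M).

Lemma coord_cts i p : dom i p -> {for p, continuous (coord i)}.
Proof.
move=> ip; have := @coord_continuous _ _ M i.
by rewrite continuous_open_subspace; [apply; rewrite inE|exact: dom_open].
Qed.

Lemma param_cts i x : (coord i @` dom i) x -> {for x, continuous (param i)}.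
Proof.
move=> ix; have := @param_continuous _ _ M i.
by rewrite continuous_open_subspace; [apply; rewrite inE|exact: image_open].
Qed.

(** Charts are homeomorphisms onto open sets. *)
Lemma coord_image_open i O : open O -> open (coord i @` (dom i `&` O)).
Proof.
move=> oO; rewrite openE => x [p [ip Op] <-].
have imx : (coord i @` dom i) (coord i p) by exists p.
have n1 : nbhs (coord i p) (coord i @` dom i).
  by apply: open_nbhs_nbhs; split=> //; exact: image_open.
have n2 : nbhs (coord i p) (param i @^-1` O).
  by apply: (param_cts imx); rewrite coordK//; exact: open_nbhs_nbhs.
apply: filterS2 n1 n2 => _ [q iq <-] /=; rewrite coordK// => Oq.
by exists q.
Qed.

Lemma metric_unit i p : dom i p -> metric i (coord i p) \in unitmx.
Proof. by move=> ip; apply: posdef_unit => u; exact: metric_posdef. Qed.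

Lemma transition_metric_change i j O : open O ->
  metric_change (coord i @` (dom i `&` (dom j `&` O))) (metric i)
    (coord j \o param i) (coord j @` (dom j `&` O)) (metric j).
Proof.
move=> oO; split.
- by apply: coord_image_open; apply: openI => //; exact: dom_open.
- by move=> _ [p [ip [jp Op]] <-] /=; rewrite coordK//; exists p.
- move=> b s _ [p [ip [jp Op]] <-]; apply: transition_smooth.
  by exists p.
- by move=> a b s _ [p [jp Op] <-]; apply: metric_smooth; exists p.
- by move=> _ [p [jp Op] <-]; exact: metric_sym.
- by move=> _ [p [ip _] <-]; exact: metric_unit.
- by move=> _ [p [ip [jp _]] <-] /=; rewrite coordK//; exact: metric_compat.
Qed.

End charts.

Section immersed.
Context {R : realType} {n m : nat}.
Variables (M : orientedRiemannian R n) (N : orientedRiemannian R m) (psi : M -> N).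
Hypothesis psi_smooth : smooth psi.

Definition chart_map (i : chart M) (j : chart N) : 'rV[R]_n -> 'rV[R]_m :=
  coord j \o psi \o param i.

Lemma chart_map_smooth i j : smooth_map_on (coord i @` (dom i `&` psi @^-1` dom j)) (chart_map i j).
Proof. exact: psi_smooth.2. Qed.

Lemma sff_norm2_eq (D : set 'rV[R]_n) (g : 'rV[R]_n -> 'M[R]_n) (h : 'rV[R]_m -> 'M[R]_m)
    (F G : 'rV[R]_n -> 'rV[R]_m) x :
  open D -> D x -> smooth_map_on D F -> (forall y, D y -> F y = G y) ->
  sff_norm2 g h F x = sff_norm2 g h G x.
Proof.
move=> oD Dx sF FG.
have p1 a c y : D y -> partial a (fun y => F y 0 c) y = partial a (fun y => G y 0 c) y.
  by move=> Dy; apply: (open_eq_partial _ oD Dy) => z /FG ->.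
have p2 a b c : partial a (partial b (fun y => F y 0 c)) x
   = partial a (partial b (fun y => G y 0 c)) x.
  by apply: (open_eq_partial _ oD Dx) => z Dz; exact: p1.
have JE : 'J F x = 'J G x.
  have dF : differentiable F x by exact: (smooth_map_differentiable sF Dx).
  have dG : differentiable G x.
    apply: near_eq_differentiable dF; near=> y; apply: FG; near: y.
    exact: open_nbhs_nbhs.
  apply/matrixP => a b; apply: etrans (jacobianE _ _ dF) _.
  exact: (etrans (p1 _ _ _ Dx) (esym (jacobianE _ _ dG))).
have sE a b : sff g h F x a b = sff g h G x a b.
  rewrite /sff JE; apply: (f_equal (fun v => v - _)); apply/rowP => c.
  rewrite [LHS]mxE [RHS]mxE; apply: f_equal2; first exact: p2.
  by apply: eq_bigr => d _; apply: eq_bigr => e _; rewrite !(p1 _ _ _ Dx) (FG _ Dx).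
rewrite /sff_norm2; apply: eq_bigr => a _; apply: eq_bigr => b _.
apply: eq_bigr => c _; apply: eq_bigr => d _.
by rewrite !sE (FG _ Dx).
Unshelve. all: by end_near. Qed.

Lemma preimage_dom_open (j : chart N) : open (psi @^-1` dom j).
Proof. by apply: open_comp; [move=> p _; exact: psi_smooth.1|exact: dom_open]. Qed.

Lemma smooth_map_sub k (D E : set 'rV[R]_n) (F : 'rV[R]_n -> 'rV[R]_k) :
  D `<=` E -> smooth_map_on E F -> smooth_map_on D F.
Proof. by move=> DE sF b s x /DE; exact: sF. Qed.

Lemma sff_norm2_chart (i i' : chart M) (j j' : chart N) p :
  dom i p -> dom i' p -> dom j (psi p) -> dom j' (psi p) ->
  sff_norm2 (metric i') (metric j') (chart_map i' j') (coord i' p)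
  = sff_norm2 (metric i) (metric j) (chart_map i j) (coord i p).
Proof.
move=> ip i'p jp j'p.
transitivity (sff_norm2 (metric i) (metric j') (chart_map i j') (coord i p)).
  have oO := preimage_dom_open j'.
  have mc := transition_metric_change i' i oO.
  have Dx : (coord i' @` (dom i' `&` (dom i `&` psi @^-1` dom j'))) (coord i' p).
    by exists p.
  have e : (coord i \o param i') (coord i' p) = coord i p by rewrite /= coordK.
  rewrite -e -(sff_norm2_source (metric j') Dx mc (@chart_map_smooth i j')).
  apply: (sff_norm2_eq _ _ (mc_open mc) Dx) => [|_ [q [i'q [iq jq]] <-]].
    apply: smooth_map_sub (@chart_map_smooth i' j').
    by move=> _ [q [i'q [_ jq]] <-]; exists q.
  by rewrite /chart_map /= !coordK.
have mc := transition_metric_change j j' (@openT N).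
pose D := coord i @` (dom i `&` psi @^-1` (dom j `&` dom j')).
have oD : open D.
  apply: coord_image_open; rewrite preimage_setI.
  by apply: openI; exact: preimage_dom_open.
have Dx : D (coord i p) by exists p.
have sF : smooth_map_on D (chart_map i j).
  apply: smooth_map_sub (@chart_map_smooth i j).
  by move=> _ [q [i'q [jq _]] <-]; exists q.
have sF' : smooth_map_on D (chart_map i j').
  apply: smooth_map_sub (@chart_map_smooth i j').
  by move=> _ [q [i'q [_ jq]] <-]; exists q.
have FE y : D y -> (coord j @` (dom j `&` (dom j' `&` [set: N]))) (chart_map i j y).
  by move=> [q [iq [jq j'q]] <-]; exists (psi q) => //; rewrite /chart_map /= coordK.
rewrite -(sff_norm2_target _ oD Dx sF FE mc).
apply: (sff_norm2_eq _ _ oD Dx sF') => _ [q [iq [jq j'q]] <-].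
by rewrite /chart_map /= !coordK.
Qed.

(** [|A|] may be computed in any charts around [p] and [psi p]; in particular in
    charts that are fixed while [p] moves. *)
Lemma normA_chart (i : chart M) (j : chart N) p : dom i p -> dom j (psi p) ->
  normA psi p = Num.sqrt (sff_norm2 (metric i) (metric j) (chart_map i j) (coord i p)).
Proof.
move=> ip jp; pose i0 := chart_at p; pose j0 := chart_at (psi p).
rewrite -(@sff_norm2_chart i i0 j j0)//; [|exact: dom_chart_at|exact: dom_chart_at].
have Fx : chart_map i0 j0 (coord i0 p) = pcoord (psi p).
  by rewrite /chart_map /= coordK//; exact: dom_chart_at.
have dF : differentiable (chart_map i0 j0) (coord i0 p).
  apply: (smooth_map_differentiable (@chart_map_smooth i0 j0)).
  by exists p => //; split; exact: dom_chart_at.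
have sE a b : second_ff psi p a b =
    sff (metric i0) (metric j0) (chart_map i0 j0) (coord i0 p) a b.
  apply/rowP => c; rewrite [LHS]mxE [RHS]mxE; apply: f_equal2.
    by rewrite [RHS]mxE Fx.
  rewrite [RHS]mxE; apply: f_equal; rewrite [RHS]mxE; apply: eq_bigr => k _.
  by rewrite [chrow _ _ _ _ _ _]mxE (jacobianE _ _ dF).
congr Num.sqrt; apply: eq_bigr => a _; apply: eq_bigr => b _.
apply: eq_bigr => c _; apply: eq_bigr => d _.
by rewrite !sE Fx.
Qed.

End immersed.

Section continuity_mx.
Context {R : realType} {T : topologicalType}.

Definition mx_cont m n (A : T -> 'M[R]_(m, n)) x :=
  forall i j, {for x, continuous (fun y => A y i j)}.

Lemma mx_cont_mul m n k (A : T -> 'M[R]_(m, n)) (B : T -> 'M[R]_(n, k)) x :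
  mx_cont A x -> mx_cont B x -> mx_cont (fun y => A y *m B y) x.
Proof.
move=> cA cB i j; rewrite (_ : (fun y => _) = (fun y => \sum_k A y i k * B y k j)).
  by apply: cont_sum => l; apply: cont_mul; [exact: cA|exact: cB].
by apply/funext => y; rewrite mxE.
Qed.

Lemma mx_cont_tr m n (A : T -> 'M[R]_(m, n)) x :
  mx_cont A x -> mx_cont (fun y => (A y)^T) x.
Proof.
move=> cA i j; rewrite (_ : (fun y => _) = (fun y => A y j i)); first exact: cA.
by apply/funext => y; rewrite mxE.
Qed.

Lemma mx_cont_sub m n (A B : T -> 'M[R]_(m, n)) x :
  mx_cont A x -> mx_cont B x -> mx_cont (fun y => A y - B y) x.
Proof.
move=> cA cB i j; rewrite (_ : (fun y => _) = (fun y => A y i j + - B y i j)).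
  by apply: cont_add; [exact: cA|apply: cont_opp; exact: cB].
by apply/funext => y; rewrite !mxE.
Qed.

Lemma mx_cont_invmx n (A : T -> 'M[R]_n) x :
  mx_cont A x -> A x \in unitmx -> mx_cont (fun y => invmx (A y)) x.
Proof. by move=> cA uA i j; exact: cont_invmx. Qed.

End continuity_mx.

Section normA_continuity.
Context {R : realType}.

Lemma smooth_cont n (D : set 'rV[R]_n) f x : smooth_on D f -> D x -> {for x, continuous f}.
Proof. by move=> sf Dx; exact/differentiable_continuous/(smooth_differentiable sf). Qed.

Lemma christoffel_cont n (D : set 'rV[R]_n) (g : 'rV[R]_n -> 'M[R]_n) k i j x :
  (forall a b, smooth_on D (fun y => g y a b)) -> D x -> g x \in unitmx ->
  {for x, continuous (christoffel g k i j)}.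
Proof.
move=> sg Dx ug; rewrite /christoffel; apply: cont_mul; first exact: cst_continuous.
apply: cont_sum => l; apply: cont_mul.
  by apply: cont_invmx => // a b; exact: smooth_cont (sg a b) Dx.
apply: cont_add; [apply: cont_add|apply: cont_opp];
  exact: smooth_cont (smooth_partial _ (sg _ _)) Dx.
Qed.

Lemma sff_norm2_cont m n (D Dg : set 'rV[R]_m) (E : set 'rV[R]_n)
    (g : 'rV[R]_m -> 'M[R]_m) (h : 'rV[R]_n -> 'M[R]_n) (F : 'rV[R]_m -> 'rV[R]_n) x :
  open D -> D x -> Dg x -> E (F x) -> smooth_map_on D F ->
  (forall a b, smooth_on Dg (fun y => g y a b)) -> g x \in unitmx ->
  (forall a b, smooth_on E (fun y => h y a b)) -> h (F x) \in unitmx ->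
  {for x, continuous (@sff_norm2 R m n g h F)}.
Proof.
move=> oD Dx Dgx EF sF sg ug sh uh.
have cF : {for x, continuous F}.
  by apply: differentiable_continuous; exact: (smooth_map_differentiable sF Dx).
have cdF a c : {for x, continuous (partial a (fun y => F y 0 c))}.
  exact: smooth_cont (smooth_partial a (sF c)) Dx.
have cJ : mx_cont (fun y => \matrix_(a, c) partial a (fun z => F z 0 c) y) x.
  move=> a c; rewrite (_ : (fun y => _) = partial a (fun z => F z 0 c)) //.
  by apply/funext => y; rewrite mxE.
pose s a b y := hess h F y a b - chrow g a b y *m \matrix_(a, c) partial a (fun z => F z 0 c) y.
have cs a b : mx_cont (s a b) x.
  apply: mx_cont_sub; last apply: mx_cont_mul => //.
    move=> i c; rewrite (_ : (fun y => _) = (fun y => partial a (partial b (fun z => F z 0 c)) y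
      + \sum_(d < n) \sum_(e < n) christoffel h c d e (F y)
       * partial a (fun z => F z 0 d) y * partial b (fun z => F z 0 e) y)); last first.
      by apply/funext => y; rewrite mxE.
    apply: cont_add.
      exact: smooth_cont (smooth_partial a (smooth_partial b (sF c))) Dx.
    apply: cont_sum => d; apply: cont_sum => e; apply: cont_mul; last exact: cdF.
    apply: cont_mul; last exact: cdF.
    apply: (@continuous_comp _ _ _ F (christoffel h c d e)) => //.
    exact: christoffel_cont sh EF uh.
  move=> i k; rewrite (_ : (fun y => _) = christoffel g k a b).
    exact: christoffel_cont sg Dgx ug.
  by apply/funext => y; rewrite mxE.
have ch : mx_cont (fun y => h (F y)) x.
  move=> a b; apply: (@continuous_comp _ _ _ F (fun z => h z a b)) => //.
  exact: smooth_cont (sh a b) EF.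
have cg : mx_cont g x by move=> a b; exact: smooth_cont (sg a b) Dgx.
have key : {for x, continuous (fun y => \sum_(a < m) \sum_(b < m) \sum_(c < m) \sum_(d < m)
    invmx (g y) a c * invmx (g y) b d * (s a b y *m h (F y) *m (s c d y)^T) 0 0)}.
  apply: cont_sum => a; apply: cont_sum => b; apply: cont_sum => c; apply: cont_sum => d.
  apply: cont_mul; first by apply: cont_mul; exact: mx_cont_invmx.
  by apply: mx_cont_mul; [exact: mx_cont_mul|exact: mx_cont_tr].
have seq y a b : D y -> sff g h F y a b = s a b y.
  move=> Dy; rewrite /sff /s; congr (_ - _ *m _); apply/matrixP => i c.
  by rewrite [RHS]mxE jacobianE//; exact: (smooth_map_differentiable sF Dy).
have eqf y : D y -> sff_norm2 g h F y = \sum_(a < m) \sum_(b < m) \sum_(c < m) \sum_(d < m)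
    invmx (g y) a c * invmx (g y) b d * (s a b y *m h (F y) *m (s c d y)^T) 0 0.
  move=> Dy; apply: eq_bigr => a _; apply: eq_bigr => b _.
  by apply: eq_bigr => c _; apply: eq_bigr => d _; rewrite !seq.
apply: near_eq_cont key.
have : \forall y \near x, D y by exact: open_nbhs_nbhs.
by apply: filterS => y Dy; exact/esym/eqf.
Qed.

Lemma normA_continuous n m (M : orientedRiemannian R n) (N : orientedRiemannian R m)
  (psi : M -> N) : smooth psi -> continuous (normA psi).
Proof.
move=> psi_smooth p; pose i := chart_at p; pose j := chart_at (psi p).
have ip : dom i p by exact: dom_chart_at.
have jp : dom j (psi p) by exact: dom_chart_at.
pose G q := Num.sqrt (sff_norm2 (metric i) (metric j) (chart_map psi i j) (coord i q)).
have GE q : dom i q -> dom j (psi q) -> normA psi q = G q.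
  exact: normA_chart.
suff cG : {for p, continuous G}.
  apply: near_eq_cont cG; near=> q; apply: esym; apply: GE; near: q.
    by apply: open_nbhs_nbhs; split=> //; exact: dom_open.
  by apply: open_nbhs_nbhs; split=> //; exact: preimage_dom_open.
  apply: (@continuous_comp _ _ _ (sff_norm2 (metric i) (metric j) (chart_map psi i j) \o coord i) Num.sqrt);
    last exact: sqrt_continuous.
  apply: continuous_comp; first exact: coord_cts.
  apply: (@sff_norm2_cont _ _ (coord i @` (dom i `&` psi @^-1` dom j)) (coord i @` dom i)
    (coord j @` dom j)).
  - exact/coord_image_open/preimage_dom_open.
  - by exists p.
  - by exists p.
  - by exists (psi p) => //; rewrite /chart_map /= coordK.
  - exact: (chart_map_smooth psi_smooth).
  - exact: metric_smooth.
  - exact: metric_unit.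
  - exact: metric_smooth.
  - by rewrite /chart_map /= coordK//; exact: metric_unit.
Unshelve. all: by end_near. Qed.

End normA_continuity.

(** * Lipschitz functions are continuous *)

Section monotone_integral.
Context d (T : measurableType d) (R : realType) (mu : {measure set T -> \bar R}).

(** The integral of a nonnegative function is a supremum over the simple
    functions below it, hence monotone without any measurability. *)
Lemma ge0_le_integral_raw (D : set T) (f g : T -> \bar R) :
  (forall x, D x -> (0 <= f x)%E) -> (forall x, D x -> (f x <= g x)%E) ->
  (\int[mu]_(x in D) f x <= \int[mu]_(x in D) g x)%E.
Proof.
move=> f0 fg; have g0 x : D x -> (0 <= g x)%E.
  by move=> Dx; apply: le_trans (f0 _ Dx) (fg _ Dx).
rewrite !ge0_integralE//; apply: ereal_sup_le => _ [h /= hf <-]; exists h => //= x.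
apply: le_trans (hf x) _; rewrite /patch; case: ifPn => // /set_mem; exact: fg.
Qed.

End monotone_integral.

Section lipschitz_continuous.
Context {R : realType}.

Lemma cont_rV (T : topologicalType) n (F : T -> 'rV[R]_n) x :
  (forall b, {for x, continuous (fun y => F y 0 b)}) -> {for x, continuous F}.
Proof.
move=> cF; rewrite (_ : F = (fun y => \sum_(b < n) F y 0 b *: delta_mx 0 b)); last first.
  by apply/funext => y; rewrite -row_sum_delta.
elim: (index_enum _) => [|b r IHr].
  rewrite (_ : (fun y => _) = cst 0); first exact: cst_continuous.
  by apply/funext => y; rewrite big_nil.
rewrite (_ : (fun y => _) = (fun y => F y 0 b *: delta_mx 0 b
    + \sum_(j <- r) F y 0 j *: delta_mx 0 j)); last first.
  by apply/funext => y; rewrite big_cons.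
apply: cvgD; last exact: IHr.
apply: cvgZ; [exact: cF|exact: cst_continuous].
Qed.

Lemma coord_le_norm n (v : 'rV[R]_n) a : `|v 0 a| <= `|v|.
Proof.
rewrite [leRHS]/Num.Def.normr /= mx_normrE.
exact: (le_bigmax _ (fun i => `|v i.1 i.2|) (0, a)).
Qed.

(** A reparametrization of the line keeping the curve [x + s t *: v] within the
    ball of radius [`|v|] for all times, with [s 0 = 0] and [s 1 = 1]. *)
Definition swing (t : R) : R := sin (pi / 2 * t).
Definition dswing (t : R) : R := pi / 2 * cos (pi / 2 * t).

Lemma swing0 : swing 0 = 0. Proof. by rewrite /swing mulr0 sin0. Qed.

Lemma swing1 : swing 1 = 1. Proof. by rewrite /swing mulr1 sin_pihalf. Qed.

Lemma swing_le1 t : `|swing t| <= 1. Proof. exact: sin_max. Qed.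

Lemma is_derive_swing (t : R) : is_derive t (1 : R) swing (dswing t).
Proof.
have h : is_derive (t : R) (1 : R) (fun u : R => pi / 2 * u) (pi / 2).
  rewrite -[X in is_derive _ _ _ X]mulr1.
  exact: (@is_deriveZ R R R id (pi / 2) t 1 1 (is_derive_id t 1)).
by rewrite /dswing mulrC; exact: is_derive1_comp.
Qed.

Lemma dswing_cont : continuous dswing.
Proof.
move=> t; suff h : {for t, continuous dswing} by exact: h.
apply: (@cont_mul R R (cst (pi / 2)) (fun u => cos (pi / 2 * u))).
  exact: cst_continuous.
apply: (@continuous_comp _ _ _ (fun u : R => pi / 2 * u) cos); last exact: continuous_cos.
apply: (@cont_mul R R (cst (pi / 2)) id); first exact: cst_continuous.
exact: cvg_id.
Qed.

Lemma dswing_le2 t : `|dswing t| <= 2.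
Proof.
have /andP[p0 p2] := pihalf_02 R.
rewrite normrM (gtr0_norm p0) -[leRHS]mulr1.
by apply: ler_pM => //; [exact: ltW|exact: ltW|exact: cos_max].
Qed.

Section swing_line.
Context {n : nat} (x v : 'rV[R]_n).

Definition swing_line (t : R) : 'rV[R]_n := swing t *: v + x.

Lemma is_derive_swing_line (t : R) : is_derive t (1 : R) swing_line (dswing t *: v).
Proof.
have ds := is_derive_swing t.
have dd : differentiable swing t by apply/derivable1_diffP.
have dl : is_derive t (1 : R) (fun u => swing u *: v) (dswing t *: v).
  have d1 := differentiableZl v dd.
  apply: DeriveDef; first exact: diff_derivable.
  by rewrite deriveE// diffZl// -deriveE// derive_val.
rewrite -[X in is_derive _ _ _ X]addr0.
exact: (is_deriveD dl (is_derive_cst x t 1)).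
Qed.

Lemma swing_line_comp m (G : 'rV[R]_n -> 'rV[R]_m) (t : R) : differentiable G (swing_line t) ->
  is_derive (t : R) (1 : R) (G \o swing_line) (dswing t *: (v *m 'J G (swing_line t))).
Proof.
move=> dG; have dl := is_derive_swing_line t.
have dd : differentiable swing_line t by apply/derivable1_diffP.
have dc : differentiable (G \o swing_line) t by exact: differentiable_comp.
apply: DeriveDef; first exact: diff_derivable.
rewrite (deriveE _ dc) (diff_comp dd dG) /= -(deriveE _ dd) derive_val.
by rewrite linearZ /= /jacobian mul_rV_lin1.
Qed.

End swing_line.

Variables (n : nat) (M : orientedRiemannian R n).

Section short_curve.
Variables (i : chart M) (x v : 'rV[R]_n).
Hypothesis inU : forall s : R, `|s| <= 1 -> (coord i @` dom i) (s *: v + x).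

Let c t : M := param i (swing_line x v t).

Let lineU t : (coord i @` dom i) (swing_line x v t).
Proof. exact/inU/swing_le1. Qed.

Let domc t : dom i (c t).
Proof. by have [q iq qE] := lineU t; rewrite /c -qE coordK. Qed.

Let coordc t : coord i (c t) = swing_line x v t.
Proof. by have [q iq qE] := lineU t; rewrite /c -qE coordK. Qed.

Let c_cont : continuous c.
Proof.
move=> t; apply: continuous_comp; last exact: param_cts.
by apply/differentiable_continuous/derivable1_diffP; have [] := is_derive_swing_line x v t.
Qed.

Let near_dom (j : chart M) t : dom j (c t) -> \forall u \near t, dom j (c u).
Proof.
move=> jt; have : nbhs (c t) (dom j) by apply: open_nbhs_nbhs; split=> //; exact: dom_open.
by move=> /c_cont.
Qed.

Let tau (j : chart M) := coord j \o param i.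

Let tau_diff (j : chart M) t : dom j (c t) -> differentiable (tau j) (swing_line x v t).
Proof.
move=> jt; apply: (smooth_map_differentiable (@transition_smooth _ _ M i j)).
by exists (c t) => //; split.
Qed.

Let dc (j : chart M) t : dom j (c t) ->
  is_derive t 1 (coord j \o c) (dswing t *: (v *m 'J (tau j) (swing_line x v t))).
Proof. by move=> jt; exact: (swing_line_comp (tau_diff jt)). Qed.

Lemma swing_C1 : C1_curve c.
Proof.
split=> // j t jt; split; first by have [] := dc jt.
have nd : \forall u \near t, derive1 (coord j \o c) u
    = dswing u *: (v *m 'J (tau j) (swing_line x v u)).
  apply: filterS (near_dom jt) => u ju; rewrite derive1E.
  by have [_ ->] := dc ju.
apply: (@near_eq_cont _ _ (fun u => dswing u *: (v *m 'J (tau j) (swing_line x v u)))).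
  by apply: filterS nd => u ->.
apply: cvgZ; first exact: dswing_cont.
suff cJ : {for t, continuous (fun u => v *m 'J (tau j) (swing_line x v u))} by exact: cJ.
apply: cont_rV => b.
have nd2 : \forall u \near t, \sum_a v 0 a * partial a (fun y => tau j y 0 b) (swing_line x v u)
   = (v *m 'J (tau j) (swing_line x v u)) 0 b.
  apply: filterS (near_dom jt) => u ju; rewrite [RHS]mxE; apply: eq_bigr => a _.
  by rewrite (jacobianE _ _ (tau_diff ju)).
apply: near_eq_cont nd2 _; apply: cont_sum => a; apply: cont_mul; first exact: cst_continuous.
apply: (@continuous_comp _ _ _ (swing_line x v) (partial a (fun y => tau j y 0 b))).
  by apply/differentiable_continuous/derivable1_diffP; have [] := is_derive_swing_line x v t.
apply: (smooth_cont (smooth_partial a (@transition_smooth _ _ M i j b))).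
by exists (c t) => //; split.
Qed.

Lemma swing_speed t : speed c t =
  `|dswing t| * Num.sqrt ((v *m metric i (swing_line x v t) *m v^T) 0 0).
Proof.
rewrite /speed; set j := chart_at (c t).
have jt : dom j (c t) by exact: dom_chart_at.
rewrite derive1E; have [_ ->] := dc jt.
rewrite /inner /gram /pcoord -/j -scalemxAl linearZ /= -scalemxAl -scalemxAr scalerA.
rewrite mxE -expr2 sqrtrM ?sqr_ge0// sqrtr_sqr; congr (_ * Num.sqrt _).
have /= := metric_compat (domc t) jt; rewrite coordc => ->.
by rewrite trmx_mul !mulmxA.
Qed.

Lemma rdist_chart_le (C : R) :
  (forall t, (v *m metric i (swing_line x v t) *m v^T) 0 0 <= C ^+ 2) -> 0 <= C ->
  (rdist (param i x) (param i (v + x)) <= (2 * C)%:E)%E.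
Proof.
move=> hC C0; apply: (@le_trans _ _ (curve_length c)).
  apply: ereal_inf_lbound; exists c => //; split; first exact: swing_C1.
    by rewrite /c /swing_line swing0 scale0r add0r.
  by rewrite /c /swing_line swing1 scale1r.
have -> : (2 * C)%:E = (\int[lebesgue_measure]_(t in `[0%R, 1%R]) cst (2 * C)%:E t)%E :> \bar R.
  have e01 : lebesgue_measure ([set` `[0%R, 1%R]] : set R) = 1%E :> \bar R.
    by rewrite lebesgue_measure_itv /= lte_fin ltr01 sube0.
  by rewrite integral_cst// [X in (_ * X)%E]e01 mule1.
apply: ge0_le_integral_raw => t _; first by rewrite lee_fin sqrtr_ge0.
rewrite lee_fin swing_speed; apply: ler_pM => //.
  exact: dswing_le2.
by rewrite -(ger0_norm C0) -sqrtr_sqr; exact: ler_wsqrtr.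
Qed.

End short_curve.

Lemma quad_form_le (v : 'rV[R]_n) (G : 'M[R]_n) :
  (v *m G *m v^T) 0 0 <= (\sum_a \sum_b `|G a b|) * `|v| ^+ 2.
Proof.
rewrite mxE exchange_big mulr_suml; apply: ler_sum => b _.
rewrite mxE !mulr_suml; apply: ler_sum => a _; rewrite mxE.
rewrite mulrAC mulrC; apply: le_trans (ler_norm _) _; rewrite !normrM.
by apply: ler_wpM2l => //; rewrite expr2; apply: ler_pM => //; exact: coord_le_norm.
Qed.

(** The swinging coordinate segment from [p] to [q] stays in a small coordinate
    ball, where the metric is bounded; its length bounds the distance. *)
Lemma rdist_local (p : M) : exists2 C : R, 0 < C &
  \forall q \near p, (rdist p q <= (C * `|coord (chart_at p) q - coord (chart_at p) p|)%:E)%E.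
Proof.
set i := chart_at p; set x := coord i p.
have ip : dom i p by exact: dom_chart_at.
pose S y := \sum_a \sum_b `|metric i y a b|.
have cS : {for x, continuous S}.
  apply: cont_sum => a; apply: cont_sum => b; apply: continuous_comp; last exact: norm_continuous.
  by apply: (smooth_cont (@metric_smooth _ _ M i a b)); exists p.
pose K := S x + 1.
have K0 : 0 < K by rewrite ltr_wpDl// sumr_ge0// => a _; rewrite sumr_ge0.
have nS : \forall y \near x, S y <= K.
  have : nbhs (S x) [set z | z <= K].
    by apply: filterS (@lt_nbhsl R (S x) K _) => [z /ltW//|]; rewrite /K ltrDl.
  by move=> /cS.
have nU : nbhs x (coord i @` dom i).
  by apply: open_nbhs_nbhs; split; [exact: image_open|exists p].
have /nbhs_normP[r /= r0 hr] : nbhs x ([set y | S y <= K] `&` coord i @` dom i).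
  exact: filterI.
exists (2 * Num.sqrt K); first by rewrite mulr_gt0// sqrtr_gt0.
have nq : \forall q \near p, dom i q /\ `|x - coord i q| < r.
  apply: filterI; first by apply: open_nbhs_nbhs; split=> //; exact: dom_open.
  have /cvgrPdist_lt/(_ r r0) := coord_cts ip; exact.
apply: filterS nq => q [iq qr].
pose v := coord i q - x.
have vr : `|v| < r by rewrite distrC.
have inB s : `|s| <= 1 -> S (s *: v + x) <= K /\ (coord i @` dom i) (s *: v + x).
  move=> s1; apply: hr => /=; rewrite opprD addrCA subrr addr0 normrN normrZ.
  by apply: le_lt_trans vr; rewrite ler_piMl.
have pE : p = param i x by rewrite coordK.
have qE : q = param i (v + x) by rewrite subrK coordK.
rewrite {1}pE {1}qE -mulrA; apply: rdist_chart_le.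
- by move=> s /inB[].
- move=> t; apply: le_trans (quad_form_le _ _) _.
  rewrite exprMn (sqr_sqrtr (ltW K0)); apply: ler_wpM2r; first exact: sqr_ge0.
  by have [] := inB _ (swing_le1 t).
- by rewrite mulr_ge0// sqrtr_ge0.
Qed.

Lemma lipschitz_continuous (f : M -> R) : lipschitz f -> continuous f.
Proof.
move=> [L L0 fL] p; have [C C0 nC] := rdist_local p.
set i := chart_at p in nC.
have ip : dom i p by exact: dom_chart_at.
apply/cvgrPdist_lt => e e0.
have e1 : 0 < e / (L * C) by rewrite divr_gt0// mulr_gt0.
have /cvgrPdist_lt/(_ _ e1) nq := coord_cts ip.
apply: filterS2 nC nq => q qC qe; rewrite -lte_fin.
apply: le_lt_trans (fL p q) _.
apply: (@le_lt_trans _ _ (L%:E * (C * `|coord i q - coord i p|)%:E)%E).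
  by apply: lee_wpmul2l => //; rewrite lee_fin ltW.
by rewrite -EFinM lte_fin mulrA mulrC -ltr_pdivlMr ?mulr_gt0// distrC.
Qed.

End lipschitz_continuous.

(** * Borel measurability of the differentiability set *)

Notation bor T := (g_sigma_algebraType (@open T)).

Section borel_sets.
Context {R : realType}.

Lemma open_bor (T : ptopologicalType) (A : set T) : open A -> measurable (A : set (bor T)).
Proof. by move=> oA; exact: sub_sigma_algebra. Qed.

Lemma closed_bor (T : ptopologicalType) (A : set T) : closed A -> measurable (A : set (bor T)).
Proof.
by move=> cA; rewrite -(setCK A); apply: measurableC; apply: open_bor; exact: closed_openC.
Qed.

Lemma open_preimage (T S : topologicalType) (D : set T) (f : T -> S) (A : set S) :
  open D -> (forall x, D x -> {for x, continuous f}) -> open A -> open (D `&` f @^-1` A).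
Proof.
move=> oD cf oA; rewrite openE => x [Dx Afx].
apply: filterI; first by apply: open_nbhs_nbhs.
by apply: (cf _ Dx); exact: open_nbhs_nbhs.
Qed.

Lemma cont_measurable (T S : ptopologicalType) (D : set T) (f : T -> S) :
  open D -> (forall x, D x -> {for x, continuous f}) ->
  measurable_fun (D : set (bor T)) (f : bor T -> bor S).
Proof.
move=> oD cf; apply: (@measurability _ _ (bor T) (bor S) D f (@open S)) => //.
by move=> _ [A oA <-]; apply: open_bor; exact: open_preimage.
Qed.

Lemma cont_measurableR (T : ptopologicalType) (D : set T) (f : T -> R) :
  open D -> (forall x, D x -> {for x, continuous f}) ->
  measurable_fun (D : set (bor T)) (f : bor T -> R).
Proof.
move=> oD cf; apply: (@measurability _ _ (bor T) _ D f _ (RGenOpens.measurableE R)).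
by move=> _ [_ [a [b ->]] <-]; apply: open_bor; apply: open_preimage => //.
Qed.

End borel_sets.

Section differentiability_set.
Context {R : realType} {n : nat}.
Definition dot (v q : 'rV[R]_n) : R := \sum_a v 0 a * q 0 a.

Lemma dot_bound (v q : 'rV[R]_n) (e : R) : (forall a, `|q 0 a| <= e) ->
  `|dot v q| <= n%:R * (`|v| * e).
Proof.
move=> qe; apply: le_trans (ler_norm_sum _ _ _) _.
rewrite mulr_natl -[X in _ *+ X](card_ord n) -sumr_const; apply: ler_sum => a _.
by rewrite normrM; apply: ler_pM => //; exact: coord_le_norm.
Qed.

Lemma dotB v q r : dot v (q - r) = dot v q - dot v r.
Proof. by rewrite -sumrB; apply: eq_bigr => a _; rewrite !mxE mulrBr. Qed.

Lemma dot_cont q : continuous (dot ^~ q).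
Proof.
move=> v; suff : {for v, continuous (dot ^~ q)} by exact.
apply: cont_sum => a; apply: cont_mul; last exact: cst_continuous.
by apply: differentiable_continuous; exact: differentiable_coord.
Qed.

Variables (U : set 'rV[R]_n) (h : 'rV[R]_n -> R).
Hypothesis oU : open U.
Hypothesis ch : forall x, U x -> {for x, continuous h}.

(** Differentiability with the slope, the tolerance and the scale all fixed: the
    differentiability set is a countable combination of these closed sets. *)
Definition almost_affine (q : 'rV[R]_n) (e d : R) : set 'rV[R]_n :=
  [set x | forall v, `|v| < d -> U (v + x) /\ `|h (v + x) - h x - dot v q| <= e * `|v|].

(** The condition is imposed on a whole ball of increments at once, including
    that it stays in [U]; this makes the set closed in the whole space. *)
Lemma almost_affine_closed q e d : 0 < d -> closed (almost_affine q e d).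
Proof.
move=> d0; rewrite -[almost_affine q e d]setCK; apply: open_closedC.
rewrite openE => x /= /existsNP[v] /not_implyP[vd /not_andP nUv].
change (nbhs x (~` almost_affine q e d)).
have [Uv|nUvx] := pselect (U (v + x)); last first.
  apply: (nbhs_normP x _).2; exists (d - `|v|) => [|y /= xy]; first by rewrite /= subr_gt0.
  move=> /(_ (v + (x - y))) []; last by rewrite -addrA subrK.
  by apply: le_lt_trans (ler_normD _ _) _; rewrite -ltrBrDl.
have [Ux|nUx] := pselect (U x); last first.
  apply: (nbhs_normP x _).2; exists d => //= y xy.
  by move=> /(_ (x - y)) []; rewrite ?subrK.
have {nUv} hv : e * `|v| < `|h (v + x) - h x - dot v q|.
  by case: nUv => // /negP; rewrite -ltNge.
have cg : {for x, continuous (fun y => `|h (v + y) - h y - dot v q|)}.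
  apply: (@continuous_comp _ _ _ (fun y => h (v + y) - h y - dot v q) Num.norm);
    last exact: norm_continuous.
  apply: cont_add; last exact: cst_continuous.
  apply: cont_add; last by apply: cont_opp; exact: ch.
  apply: (@continuous_comp _ _ _ (fun y => v + y) h); last exact: ch.
  by apply: differentiable_continuous; apply: (@differentiableD _ _ _ (cst v) id).
have : nbhs `|h (v + x) - h x - dot v q| [set z | e * `|v| < z].
  exact: lt_nbhsr.
move=> /cg nc; apply: (@filterS _ (nbhs x) _ _ _ _ nc) => y /= hy /(_ v vd) [_]; apply/negP.
by rewrite -ltNge.
Qed.

Lemma differentiable_almost_affine x e : U x -> differentiable h x -> 0 < e ->
  exists d0, 0 < d0 /\ forall q : 'rV[R]_n,
    (forall a, `|partial a h x - q 0 a| <= e / (n%:R + 1)) ->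
    forall d, d <= d0 -> almost_affine q (2 * e) d x.
Proof.
move=> Ux dh e0.
have nU : \forall v \near (0 : 'rV[R]_n), U (v + x).
  have : nbhs (0 + x) U by rewrite add0r; exact: open_nbhs_nbhs.
  have cv : {for 0, continuous (fun v : 'rV[R]_n => v + x)}.
    by apply: differentiable_continuous; apply: (@differentiableD _ _ _ id (cst x)).
  by move=> /cv.
have nd := differentiable_eps dh e0.
have [d0 /= d00 hd] := (nbhs_normP _ _).1 (filterI nU nd).
exists d0; split=> // q hq d dd0 v vd.
have [|Uv hv] := hd v; first by rewrite /= sub0r normrN; exact: lt_le_trans vd dd0.
split=> //; pose p : 'rV[R]_n := \row_a partial a h x.
have dE : 'd h x v = dot v p.
  by rewrite (diff_partials _ dh); apply: eq_bigr => a _; rewrite mxE.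
have -> : h (v + x) - h x - dot v q = (h (v + x) - h x - 'd h x v) + dot v (p - q).
  by rewrite dotB dE addrA subrK.
apply: le_trans (ler_normD _ _) _; rewrite mulrDl mul1r mulrDl; apply: lerD => //.
apply: le_trans (dot_bound (e := e / (n%:R + 1)) _ _) _ => [a|]; first by rewrite !mxE.
rewrite mulrCA mulrC ler_wpM2r// mulrCA; apply: ler_piMr; first exact: ltW.
by rewrite ler_pdivrMr ?ltr_wpDl// mul1r lerDl.
Qed.

(** Almost affine approximations at the same point have close slopes, as is seen
    on a small increment along the axis [a]. *)
Lemma almost_affine_slope q q' e e' d d' x a : 0 < d -> 0 < d' ->
  almost_affine q e d x -> almost_affine q' e' d' x ->
  `|q 0 a - q' 0 a| <= (e + e') * `|delta_mx 0 a : 'rV[R]_n|.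
Proof.
move=> d0 d0' hq hq'; pose ea := delta_mx 0 a : 'rV[R]_n.
pose t := Num.min d d' / (`|ea| + 1).
have m0 : 0 < Num.min d d' by rewrite lt_min d0.
have t0 : 0 < t by rewrite divr_gt0// ltr_wpDl.
have tm : `|t *: ea| < Num.min d d'.
  rewrite normrZ gtr0_norm// /t mulrAC ltr_pdivrMr ?ltr_wpDl// ltr_pM2l//.
  by rewrite ltrDl.
have [|_ h1] := hq (t *: ea); first by rewrite (lt_le_trans tm)// ge_min lexx.
have [|_ h2] := hq' (t *: ea); first by rewrite (lt_le_trans tm)// ge_min lexx orbT.
have dE r : dot (t *: ea) r = t * r 0 a.
  rewrite /dot (bigD1 a)//= big1 => [|b ba]; first by rewrite !mxE !eqxx mulr1 addr0.
  by rewrite !mxE (negbTE ba) andbF mulr0 mul0r.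
rewrite -(ler_pM2l t0) -{1}(gtr0_norm t0) -normrM mulrBr -!dE.
set H := h _ - h x in h1 h2.
have -> : dot (t *: ea) q - dot (t *: ea) q' = (H - dot (t *: ea) q') - (H - dot (t *: ea) q).
  by rewrite opprB [RHS]addrC addrA subrK.
apply: le_trans (ler_normB _ _) _; rewrite addrC.
have -> : t * ((e + e') * `|ea|) = e * `|t *: ea| + e' * `|t *: ea|.
  by rewrite -mulrDl normrZ gtr0_norm// mulrCA.
exact: lerD.
Qed.

(** If [h] is almost affine at [x] for every tolerance, the slopes form a Cauchy
    family; the limit slope is obtained as a supremum of lower bounds. *)
Lemma almost_affine_differentiable x :
  (forall e, 0 < e -> exists q d, 0 < d /\ almost_affine q e d x) -> differentiable h x.
Proof.
move=> H; have H' (k : nat) : exists qd : 'rV[R]_n * R,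
    0 < qd.2 /\ almost_affine qd.1 k.+1%:R^-1 qd.2 x.
  by have [|q [d ?]] := H k.+1%:R^-1; [rewrite invr_gt0|exists (q, d)].
have [qd qdP] := choice H'.
pose q k := (qd k).1; pose d k := (qd k).2; pose e k : R := k.+1%:R^-1.
have d0 k : 0 < d k by have [] := qdP k.
have aff k : almost_affine (q k) (e k) (d k) x by have [] := qdP k.
pose N a := `|delta_mx 0 a : 'rV[R]_n|.
pose B := \sum_a N a.
have NB a : N a <= B by rewrite /B (bigD1 a)//= lerDl; apply: sumr_ge0 => b _; exact: normr_ge0.
have B0 : 0 <= B by apply: sumr_ge0 => a _; exact: normr_ge0.
have qq a k l : q k 0 a - e k * B <= q l 0 a + e l * B.
  rewrite lerBlDr -addrA -mulrDl -lerBlDl.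
  apply: le_trans (ler_norm _) _.
  apply: le_trans (almost_affine_slope a (d0 k) (d0 l) (aff k) (aff l)) _.
  rewrite (addrC (e l)); apply: ler_wpM2l (NB a).
  by rewrite addr_ge0// invr_ge0.
pose L : 'rV[R]_n := \row_a sup [set q k 0 a - e k * B | k in [set: nat]].
have LP a k : `|L 0 a - q k 0 a| <= e k * B.
  rewrite mxE ler_distl; apply/andP; split.
    apply: sup_upper_bound; last by exists k.
    split; first by exists (q k 0 a - e k * B); exists k.
    by exists (q k 0 a + e k * B) => _ [l _ <-].
  apply: sup_le_ub; first by exists (q k 0 a - e k * B); exists k.
  by move=> _ [l _ <-].
have glin : linear (dot ^~ L).
  move=> c u v; rewrite /dot scaler_sumr -big_split /=; apply: eq_bigr => a _.
  by rewrite [(c *: u + v) 0 a]mxE [(c *: u) 0 a]mxE mulrDl -mulrA.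
pose glM := GRing.isLinear.Build _ _ _ _ _ glin.
pose gL : {linear _ -> _} := HB.pack (dot ^~ L) glM.
suff [] : differentiable h x /\ 'd h x = gL :> (_ -> _) by [].
apply: eps_differentiable => [|eps eps0]; first exact: dot_cont.
have [k ke] : exists k, e k * (1 + n%:R * B) <= eps.
  exists (Num.truncn ((1 + n%:R * B) / eps)).
  rewrite /e mulrC ler_pdivrMr ?ltr0n// -ler_pdivrMl// mulrC ltW//.
  by rewrite truncnS_gt.
have nd : nbhs (0 : 'rV[R]_n) [set v | `|v| < d k].
  apply: (nbhs_normP (0 : 'rV[R]_n) _).2; exists (d k); first exact: d0.
  by move=> v /=; rewrite sub0r normrN.
apply: (@filterS _ (nbhs (0 : 'rV[R]_n)) _ _ _ _ nd) => v /= vd.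
have [_ hv] := aff k v vd.
have -> : h (v + x) - h x - dot v L = (h (v + x) - h x - dot v (q k)) + dot v (q k - L).
  by rewrite dotB addrA subrK.
apply: le_trans (ler_normD _ _) _.
apply: le_trans (lerD hv (@dot_bound v (q k - L) (e k * B) _)) _.
  by move=> a; rewrite [(q k - L) 0 a]mxE [(- L) 0 a]mxE distrC; exact: LP.
have -> : e k * `|v| + n%:R * (`|v| * (e k * B)) = e k * (1 + n%:R * B) * `|v| by ring.
exact: ler_wpM2r.
Qed.

Definition rat_row (r : 'rV[rat]_n) : 'rV[R]_n := map_mx ratr r.

(** Rational slopes and scales suffice, so that only countably many closed sets
    occur. *)
Lemma differentiable_setE : U `&` [set x | differentiable h x] =
  U `&` \bigcap_(k : nat) \bigcup_(m : nat) \bigcup_(r : 'rV[rat]_n)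
     almost_affine (rat_row r) k.+1%:R^-1 m.+1%:R^-1.
Proof.
apply/seteqP; split=> x [Ux].
  move=> /= dh; split=> // k _.
  have k0 : 0 < (k.+1%:R^-1 / 2 : R) by rewrite divr_gt0// invr_gt0.
  have [d [d0 hd]] := differentiable_almost_affine Ux dh k0.
  exists (Num.truncn d^-1) => //.
  pose eta : R := k.+1%:R^-1 / 2 / (n%:R + 1).
  have eta0 : 0 < eta by rewrite divr_gt0// ltr_wpDl.
  have /choice[r rP] : forall a : 'I_n, exists z : rat, `|partial a h x - ratr z| <= eta.
    move=> a; have [|z /andP[z1 z2]] := @rat_in_itvoo R (partial a h x - eta) (partial a h x + eta).
      by rewrite ltrD2l gtrN.
    by exists z; rewrite ler_distlC ltW//= ltW.
  exists (\row_a r a) => //.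
  have -> : k.+1%:R^-1 = 2 * (k.+1%:R^-1 / 2) :> R by rewrite mulrC divfK.
  apply: hd => [a|]; first by rewrite !mxE; exact: rP.
  by rewrite invf_ple ?posrE// ltW// truncnS_gt.
move=> H; split=> //; apply: almost_affine_differentiable => e e0.
have [m _ [r _ hr]] := H (Num.truncn e^-1) Logic.I.
exists (rat_row r), m.+1%:R^-1; split; first by rewrite invr_gt0.
move=> v vm; have [Uv hv] := hr v vm; split=> //.
apply: le_trans hv _; apply: ler_wpM2r => //.
by rewrite invf_ple ?posrE// ltW// truncnS_gt.
Qed.

Lemma differentiable_set_measurable :
  measurable (U `&` [set x | differentiable h x] : set (bor 'rV[R]_n)).
Proof.
rewrite differentiable_setE; apply: measurableI; first exact: open_bor.
apply: bigcapT_measurable => k; apply: bigcupT_measurable => m.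
apply: countable_bigcupT_measurable; first exact: countableP.
by move=> r; apply: closed_bor; apply: almost_affine_closed; rewrite invr_gt0.
Qed.

End differentiability_set.

(** * Measurability of the gradient *)

Section partial_measurability.
Context {R : realType} {n : nat}.
Variables (U : set 'rV[R]_n) (h : 'rV[R]_n -> R).
Hypothesis oU : open U.
Hypothesis ch : forall x, U x -> {for x, continuous h}.

Lemma harmonic_dnbhs : (fun k : nat => k.+1%:R^-1 : R) @ \oo --> 0^'.
Proof.
move=> A nA.
have H : \forall k \near \oo, (k.+1%:R^-1 : R) != 0 -> A k.+1%:R^-1.
  exact: (@cvg_harmonic R _ nA).
by apply: filterS H => k; apply; rewrite invr_eq0 pnatr_eq0.
Qed.

(** A partial derivative is a limit of difference quotients along the scales
    [1 / k.+1].  They are taken for the extension of [h] by [0] outside [U],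
    which is measurable on the whole space. *)
Lemma partial_measurable a :
  measurable_fun (U `&` [set x | differentiable h x] : set (bor 'rV[R]_n))
    (partial a h : bor 'rV[R]_n -> R).
Proof.
pose h' := h \_ U; pose ea := delta_mx 0 a : 'rV[R]_n.
have mh' : measurable_fun [set: bor 'rV[R]_n] (h' : bor 'rV[R]_n -> R).
  have mU : measurable (U : set (bor 'rV[R]_n)) by exact: open_bor.
  exact: ((measurable_restrictT _ mU).1 (cont_measurableR oU ch)).
pose D k (x : 'rV[R]_n) : R := (k.+1%:R^-1)^-1 * (h' (k.+1%:R^-1 *: ea + x) - h' x).
have mD k : measurable_fun [set: bor 'rV[R]_n] (D k : bor 'rV[R]_n -> R).
  apply: measurable_funM => //; apply: measurable_funB => //.
  apply: (@measurableT_comp _ _ _ _ _ _ (h' : bor 'rV[R]_n -> R) _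
    ((fun x => k.+1%:R^-1 *: ea + x) : bor 'rV[R]_n -> bor 'rV[R]_n)) => //.
  apply: cont_measurable => [|x _]; first exact: openT.
  by apply: differentiable_continuous; apply: (@differentiableD _ _ _ (cst _) id).
apply: (@measurable_fun_cvg _ _ _ _ (D : nat -> bor 'rV[R]_n -> R)) => [k|x [Ux /= dh]].
  exact: measurable_funS (mD k).
have hh' : \near x, h x = h' x.
  have nU : nbhs x U by exact: open_nbhs_nbhs.
  by apply: filterS nU => y Uy; rewrite /h' patchT// inE.
have dh' : derivable h' x ea by apply: near_eq_derivable hh' _; exact: diff_derivable.
rewrite (near_eq_partial a hh').
exact: (cvg_comp _ _ harmonic_dnbhs dh').
Qed.

End partial_measurability.

Section chart_cover.
Context {R : realType} {n : nat} (M : orientedRiemannian R n).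

Lemma countable_bigcup_measurable d (T : measurableType d) (I : Type) (B : set I) (F : I -> set T) :
  countable B -> (forall V, B V -> measurable (F V)) -> measurable (\bigcup_(V in B) F V).
Proof.
move=> /countable_injP[g gi] mF.
have -> : \bigcup_(V in B) F V = \bigcup_(k : nat) \bigcup_(V in B `&` [set V | g V = k]) F V.
  apply/seteqP; split=> x; first by move=> [V BV Fx]; exists (g V) => //; exists V.
  by move=> [k _ [V [BV _] Fx]]; exists V.
apply: bigcupT_measurable => k.
have [[V [BV gV]]|noV] := pselect (exists V, B V /\ g V = k).
  rewrite (_ : \bigcup_(_ in _) _ = F V); first exact: mF.
  apply/seteqP; split=> x; last by move=> Fx; exists V.
  move=> [W [BW gW] FW]; suff -> : V = W by [].
  by apply: gi; rewrite ?inE// gV.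
rewrite (_ : \bigcup_(_ in _) _ = set0) // -subset0 => x [V [BV gV] _].
by apply: noV; exists V.
Qed.

(** Lindeloef: countably many charts cover the manifold. *)
Lemma measurable_fun_charts (phi : borel M -> R) :
  (forall i : chart M, measurable_fun (dom i : set (borel M)) phi) ->
  measurable_fun [set: borel M] phi.
Proof.
move=> mphi _ A mA; rewrite setTI.
have [B cB [Bo Bb]] := @space_second_countable _ _ M.
pose G := B `&` [set V | exists i : chart M, V `<=` dom i].
have -> : phi @^-1` A = \bigcup_(V in G) (V `&` phi @^-1` A).
  apply/seteqP; split=> p; last by move=> [V _ []].
  move=> Ap; pose i := chart_at p.
  have np : nbhs p (dom i).
    by apply: open_nbhs_nbhs; split; [exact: dom_open|exact: dom_chart_at].
  have [V [BV Vp] Vi] := Bb p _ np.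
  by exists V => //; split=> //; exists i.
apply: countable_bigcup_measurable; first by apply: sub_countable cB; apply: subset_card_le => V [].
move=> V [BV [i Vi]].
have mV : measurable (V : set (borel M)) by apply: open_bor; exact: Bo.
have mi : measurable (dom i : set (borel M)) by apply: open_bor; exact: dom_open.
rewrite (_ : V `&` _ = V `&` (dom i `&` phi @^-1` A)); first exact: measurableI (mphi i mi _ mA).
by rewrite setIA (setIidl Vi).
Qed.

End chart_cover.

Section gradient.
Context {R : realType} {n : nat} (M : orientedRiemannian R n).
Variable f : M -> R.
Hypothesis cf : continuous f.

Definition chart_grad (i : chart M) (x : 'rV[R]_n) : 'rV[R]_n :=
  if `[< differentiable (f \o param i) x >]
  then (\row_a partial a (f \o param i) x) *m invmx (metric i x) else 0.

Let tau (i j : chart M) := coord j \o param i.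

Lemma differentiable_chart (i j : chart M) p : dom i p -> dom j p ->
  differentiable (f \o param j) (coord j p) -> differentiable (f \o param i) (coord i p).
Proof.
move=> ip jp dj; have mc := transition_metric_change i j (@openT M).
have Dx : (coord i @` (dom i `&` (dom j `&` [set: M]))) (coord i p) by exists p.
have te : tau i j (coord i p) = coord j p by rewrite /tau /= coordK.
apply: (@near_eq_differentiable _ _ _ ((f \o param j) \o tau i j)).
  have nD : nbhs (coord i p) (coord i @` (dom i `&` (dom j `&` [set: M]))).
    by apply: open_nbhs_nbhs; split=> //; exact: mc_open mc.
  by apply: filterS nD => _ [q [iq [jq _]] <-]; rewrite /tau /= !coordK.
by apply: differentiable_comp; [exact: (mc_diff mc Dx)|rewrite te].
Qed.

(** The components of the gradient in a fixed chart [i], however the preferred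
    chart at [p] varies: the gradient is a tangent vector. *)
Lemma grad_chart (i : chart M) p : dom i p ->
  grad f p *m 'J (coord i \o param (chart_at p)) (pcoord p) = chart_grad i (coord i p).
Proof.
move=> ip; set j := chart_at p; have jp : dom j p by exact: dom_chart_at.
rewrite /grad /chart_grad /pcoord -/j.
have [dj|ndj] := pselect (differentiable (f \o param j) (coord j p)); last first.
  have ndi : ~ differentiable (f \o param i) (coord i p).
    by move=> di; apply: ndj; exact: differentiable_chart di.
  by rewrite (asboolF ndj) (asboolF ndi) mul0mx.
have di : differentiable (f \o param i) (coord i p) by exact: differentiable_chart dj.
rewrite (asboolT dj) (asboolT di).
have mc := transition_metric_change j i (@openT M).
have Dx : (coord j @` (dom j `&` (dom i `&` [set: M]))) (coord j p) by exists p.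
have te : tau j i (coord j p) = coord i p by rewrite /tau /= coordK.
have dt : differentiable (tau j i) (coord j p) by exact: (mc_diff mc Dx).
have rE : \row_a partial a (f \o param j) (coord j p) =
    (\row_a partial a (f \o param i) (coord i p)) *m ('J (tau j i) (coord j p))^T.
  apply/rowP => a; rewrite [LHS]mxE [RHS]mxE.
  rewrite (@open_eq_partial _ _ _ _ ((f \o param i) \o tau j i) _ _ (mc_open mc) Dx); last first.
    by move=> _ [q [jq [iq _]] <-]; rewrite /tau /= !coordK.
  rewrite (partial_comp a dt); last by rewrite te.
  apply: eq_bigr => b _; rewrite te [(\row__ _) _ _]mxE [('J _ _)^T _ _]mxE.
  by rewrite (jacobianE _ _ dt) mulrC.
rewrite rE /gram /pcoord -/j -te (mc_invmx mc Dx) -/(tau j i).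
by rewrite !mulmxA.
Qed.

Lemma measurable_chart_grad (i : chart M) a :
  measurable_fun (coord i @` dom i : set (bor 'rV[R]_n))
    ((fun x => chart_grad i x 0 a) : bor 'rV[R]_n -> R).
Proof.
set U := coord i @` dom i; set h := f \o param i.
have oU : open U by exact: image_open.
have ch x : U x -> {for x, continuous h}.
  by move=> Ux; apply: continuous_comp; [exact: param_cts|exact: cf].
have mD := differentiable_set_measurable oU ch.
have mU : measurable (U : set (bor 'rV[R]_n)) by exact: open_bor.
have -> : U = (U `&` [set x | differentiable h x])
    `|` (U `\` (U `&` [set x | differentiable h x])).
  by rewrite setDUK//; exact: subIsetl.
apply/measurable_funU => //; first exact: measurableD.
split.
  apply: (@eq_measurable_fun _ _ (bor 'rV[R]_n) R _
    (fun x => \sum_b partial b h x * invmx (metric i x) b a)).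
    move=> x /set_mem [Ux /= dh]; rewrite /chart_grad asboolT// mxE.
    by apply: eq_bigr => b _; rewrite mxE.
  apply: measurable_sum => b; apply: measurable_funM; first exact: partial_measurable.
  apply: (@measurable_funS _ _ _ _ (U : set (bor 'rV[R]_n))) => //.
  apply: cont_measurableR => // x Ux.
  apply: cont_invmx => [b' c'|]; first exact: (smooth_cont (@metric_smooth _ _ M i b' c')).
  by case: Ux => p ip <-; exact: metric_unit.
apply: (@eq_measurable_fun _ _ (bor 'rV[R]_n) R _ (cst 0)) => // x /set_mem [Ux nD].
rewrite /chart_grad asboolF ?mxE// => dh.
by apply: nD.
Qed.

Lemma measurable_grad : measurable_field (grad f).
Proof.
move=> i a; apply: (@eq_measurable_fun _ _ (borel M) R _
   ((fun x => chart_grad i x 0 a) \o coord i : borel M -> R)).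
  by move=> p /set_mem ip; rewrite grad_chart.
apply: (@measurable_comp _ _ _ _ _ _ (coord i @` dom i : set (bor 'rV[R]_n))) => //.
- by apply: open_bor; exact: image_open.
- exact: measurable_chart_grad.
- by apply: cont_measurable => [|p]; [exact: dom_open|exact: coord_cts].
Qed.

Lemma inner_chart (i : chart M) (p : M) u v : dom i p ->
  let J := 'J (coord i \o param (chart_at p)) (pcoord p) in
  inner p u v = ((u *m J) *m metric i (coord i p) *m (v *m J)^T) 0 0.
Proof.
move=> ip; rewrite /inner /gram /pcoord (metric_compat (dom_chart_at p) ip).
by rewrite trmx_mul !mulmxA.
Qed.

Lemma measurable_grad_norm : measurable_fun [set: borel M]
  ((fun p => inner p (grad f p) (grad f p)) : borel M -> R).
Proof.
apply: measurable_fun_charts => i.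
pose Y (p : M) := grad f p *m 'J (coord i \o param (chart_at p)) (pcoord p).
apply: (@eq_measurable_fun _ _ (borel M) R _
  (fun p => \sum_b (\sum_a Y p 0 a * metric i (coord i p) a b) * Y p 0 b)).
  move=> p /set_mem ip; rewrite (inner_chart _ _ ip) /= mxE.
  apply: eq_bigr => b _; rewrite [(Y p *m _) _ _]mxE; congr (_ * _).
  by rewrite [RHS]mxE.
apply: measurable_sum => b; apply: measurable_funM; last exact: measurable_grad.
apply: measurable_sum => a; apply: measurable_funM; first exact: measurable_grad.
apply: cont_measurableR => [|p ip]; first exact: dom_open.
apply: (@continuous_comp _ _ _ (coord i) (fun x => metric i x a b)); first exact: coord_cts.
by apply: (smooth_cont (@metric_smooth _ _ M i a b)); exists p.
Qed.

End gradient.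

(** * Local finiteness of the volume *)

Section local_finiteness.
Context {R : realType}.

(** By induction on the dimension: the inner integral vanishes unless the outer
    variable lies in the side of the cube. *)
Lemma integralRn_box n (f : 'rV[R]_n -> \bar R) (c : 'rV[R]_n) (r C : R) :
  0 <= r -> 0 <= C -> (forall x, (0 <= f x)%E) -> (forall x, (f x <= C%:E)%E) ->
  (forall (x : 'rV[R]_n) a, r < `|x 0 a - c 0 a| -> f x = 0%E) ->
  (0 <= integralRn f)%E /\ (integralRn f <= (C * (2 * r) ^+ n)%:E)%E.
Proof.
elim: n f c C => [|m IHm] f c C r0 C0 f0 fC fs.
  by rewrite /= expr0 mulr1; split; [exact: f0|exact: fC].
pose F t (v : 'rV[R]_m) : 'rV[R]_m.+1 := row_mx (t%:M : 'M[R]_1) v.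
pose c0 : R := c 0 ord0; pose c' : 'rV[R]_m := \row_a c 0 (lift ord0 a).
have F0 t v : F t v 0 ord0 = t.
  by rewrite [LHS]mxE; case: splitP => // j _; rewrite (ord1 j) mxE eqxx.
have FS t v a : F t v 0 (lift ord0 a) = v 0 a.
  rewrite [LHS]mxE; case: splitP => [j|j]; first by rewrite (ord1 j).
  by rewrite /= /bump leq0n => -[/val_inj ->].
have inner0 t : (0 <= integralRn (f \o F t))%E /\
    (integralRn (f \o F t) <= (C * (2 * r) ^+ m)%:E)%E.
  apply: (IHm _ c') => // [v|v|v a va]; [exact: f0|exact: fC|].
  by apply: (fs _ (lift ord0 a)); rewrite FS; move: va; rewrite mxE.
pose K := C * (2 * r) ^+ m.
have K0 : 0 <= K by rewrite mulr_ge0// exprn_ge0// mulr_ge0.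
pose I := [set` `[c0 - r, c0 + r]] : set R.
have IE : integralRn f = (\int[lebesgue_measure]_(t in [set: R]) integralRn (f \o F t))%E by [].
split; first by rewrite IE; apply: integral_ge0 => t _; have [] := inner0 t.
rewrite IE.
have le1 : (\int[lebesgue_measure]_(t in [set: R]) integralRn (f \o F t)
    <= \int[lebesgue_measure]_(t in [set: R]) ((cst K%:E : R -> \bar R) \_ I) t)%E.
  apply: ge0_le_integral_raw => t _; first by have [] := inner0 t.
  rewrite /patch; case: ifPn => [_|/negP tI]; first by have [] := inner0 t.
  have [] := IHm (f \o F t) c' 0 r0 (lexx _) _ _ _.
  - by move=> v; exact: f0.
  - move=> v; rewrite /= (fs _ ord0)// F0 ltNge ler_distl.
    by apply/negP => h; apply: tI; rewrite inE /I /= in_itv /=.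
  - move=> v a va; apply: (fs _ (lift ord0 a)); rewrite FS.
    by move: va; rewrite mxE.
  - by rewrite mul0r.
apply: le_trans le1 _; rewrite -integral_mkcond.
have muI : lebesgue_measure I = (2 * r)%:E :> \bar R.
  rewrite /I lebesgue_measure_itv /= lte_fin.
  case: ltP => [_|]; first by rewrite -EFinD; congr EFin; ring.
  move=> r1; congr EFin; lra.
have mI : measurable I by exact: measurable_itv.
by rewrite integral_cst// [X in (_ * X)%E]muI -EFinM lee_fin /K exprSr mulrA.
Qed.

Variables (n : nat) (M : orientedRiemannian R n) (dv : {measure set (borel M) -> \bar R}).
Hypothesis hdv : is_volume dv.

Lemma volume_locally_finite (p : M) : exists O : set M, [/\ open O, O p & (dv O < +oo)%E].
Proof.
pose i := chart_at p; pose x := coord i p.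
have ip : dom i p by exact: dom_chart_at.
have oU : open (coord i @` dom i) by exact: image_open.
have Ux : (coord i @` dom i) x by exists p.
pose S y := Num.sqrt (\det (metric i y)).
have cS : {for x, continuous S}.
  apply: (@continuous_comp _ _ _ (fun y => \det (metric i y)) Num.sqrt); last exact: sqrt_continuous.
  by apply: cont_det => a b; exact: (smooth_cont (@metric_smooth _ _ M i a b)).
pose K := S x + 1.
have K0 : 0 <= K by rewrite addr_ge0// sqrtr_ge0.
have nS : \forall y \near x, S y <= K.
  have : nbhs (S x) [set z | z <= K].
    by apply: filterS (@lt_nbhsl R (S x) K _) => [z /ltW//|]; rewrite /K ltrDl.
  by move=> /cS.
have [r /= r0 hr] := (nbhs_normP x _).1 nS.
pose O := dom i `&` coord i @^-1` [set y | `|x - y| < r].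
have oB : open [set y | `|x - y| < r].
  rewrite (_ : [set y | _] = ball_ Num.norm x r) //.
  by rewrite ball_normE; exact: ball_open.
have oO : open O.
  by apply: (open_preimage (dom_open i) _ oB) => q; exact: coord_cts.
exists O; split=> //; first by split=> //=; rewrite subrr normr0.
rewrite (hdv (i := i)); [|exact: open_bor|by move=> q []].
have [] := @integralRn_box n (fun y => if y \in coord i @` O
   then (Num.sqrt (\det (metric i y)))%:E else 0%E) x r K (ltW r0) K0 _ _ _.
- by move=> y; case: ifP => // _; rewrite lee_fin sqrtr_ge0.
- move=> y; case: ifP => [/set_mem[q [iq qr] <-]|_]; last by rewrite lee_fin.
  by rewrite lee_fin; exact: hr.
- move=> y a ya; rewrite memNset// => -[q [iq /= qr] qy]; move: ya; rewrite -qy.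
  apply/negP; rewrite -leNgt; apply: ltW; apply: le_lt_trans qr.
  rewrite distrC; have := coord_le_norm (x - coord i q) a.
  by rewrite !mxE.
- by move=> _ /le_lt_trans; apply; rewrite ltry.
Qed.

Lemma compact_finite_volume (K : set M) : compact K ->
  exists O : set M, [/\ open O, K `<=` O & (dv O < +oo)%E].
Proof.
rewrite compact_cover => cK.
have [W WP] := choice volume_locally_finite.
have [D _ KD] : finite_subset_cover [set: M] W K.
  by apply: cK => [p _|p _]; [have [] := WP p|exists p => //; have [] := WP p].
have key (s : seq M) : open (\bigcup_(p in [set` s]) W p) /\
    (dv (\bigcup_(p in [set` s]) W p) < +oo)%E.
  elim: s => [|p s [os fs]].
    rewrite (_ : \bigcup_(_ in _) _ = set0); first by rewrite measure0; split=> //; exact: open0.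
    by rewrite -subset0 => q [].
  have [op _ fp] := WP p.
  have -> : \bigcup_(q in [set` p :: s]) W q = W p `|` \bigcup_(q in [set` s]) W q.
    apply/seteqP; split=> q.
      by move=> [z /=]; rewrite inE => /orP[/eqP ->|zs] Oz; [left|right; exists z].
    by move=> [Oq|[z zs Oz]]; [exists p => //=; rewrite mem_head|exists z => //=; rewrite inE zs orbT].
  split; first exact: openU.
  apply: (@le_lt_trans _ _ (dv (W p) + dv (\bigcup_(q in [set` s]) W q))%E).
    by apply: measureU2; exact: open_bor.
  exact: lte_add_pinfty.
have [oD fD] := key (finmap.enum_fset D).
by exists (\bigcup_(p in [set` finmap.enum_fset D]) W p).
Qed.

End local_finiteness.

(** * Integral inequalities *)

Section integral_comparison.
Context d (T : measurableType d) (R : realType) (mu : {measure set T -> \bar R}).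

(** The common part [min (G, B)] has a finite integral, so removing it from
    [int B <= int G] compares the integrals of the positive and negative parts of
    [G - B], the second of which is finite.  Passing to [H] enlarges the first
    and diminishes the second; [int G] may be infinite. *)
Lemma integral_ge0_of_le (G B H : T -> R) :
  measurable_fun [set: T] G -> measurable_fun [set: T] B ->
  (forall x, 0 <= G x) -> (forall x, 0 <= B x) -> (forall x, G x - B x <= H x) ->
  (\int[mu]_x (B x)%:E <= \int[mu]_x (G x)%:E)%E -> (\int[mu]_x (B x)%:E < +oo)%E ->
  (0 <= \int[mu]_x (H x)%:E)%E.
Proof.
move=> mG mB G0 B0 GBH BG Bfin.
pose m x := Num.min (G x) (B x); pose P x := Num.max (G x - B x) 0.
pose N x := Num.max (B x - G x) 0.
have mm : measurable_fun [set: T] m by exact: measurable_minr.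
have mP : measurable_fun [set: T] P by apply: measurable_maxr => //; exact: measurable_funB.
have mN : measurable_fun [set: T] N by apply: measurable_maxr => //; exact: measurable_funB.
have m0 x : 0 <= m x by rewrite le_min G0 B0.
have P0 x : 0 <= P x by rewrite le_max lexx orbT.
have N0 x : 0 <= N x by rewrite le_max lexx orbT.
have split (f g h : T -> R) : measurable_fun [set: T] f -> measurable_fun [set: T] g ->
    (forall x, 0 <= f x) -> (forall x, 0 <= g x) -> (forall x, h x = f x + g x) ->
    (\int[mu]_x (h x)%:E = \int[mu]_x (f x)%:E + \int[mu]_x (g x)%:E)%E.
  move=> mf mg f0 g0 hE; under eq_integral do rewrite hE EFinD.
  by rewrite ge0_integralD//; [move=> x _; rewrite lee_fin|exact/measurable_EFinP|
    move=> x _; rewrite lee_fin|exact/measurable_EFinP].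
have GE := split P m G mP mm P0 m0.
have BE := split N m B mN mm N0 m0.
have {}GE : (\int[mu]_x (G x)%:E = \int[mu]_x (P x)%:E + \int[mu]_x (m x)%:E)%E.
  by apply: GE => x; rewrite /P /m; case: (leP (G x) (B x)) => h; case: leP => h'; lra.
have {}BE : (\int[mu]_x (B x)%:E = \int[mu]_x (N x)%:E + \int[mu]_x (m x)%:E)%E.
  by apply: BE => x; rewrite /N /m; case: (leP (G x) (B x)) => h; case: leP => h'; lra.
have im0 : (0 <= \int[mu]_x (m x)%:E)%E by apply: integral_ge0 => x _; rewrite lee_fin.
have iN0 : (0 <= \int[mu]_x (N x)%:E)%E by apply: integral_ge0 => x _; rewrite lee_fin.
have mfin : (\int[mu]_x (m x)%:E)%E \is a fin_num.
  rewrite ge0_fin_numE//; apply: le_lt_trans Bfin.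
  by rewrite BE leeDr.
have Nfin : (\int[mu]_x (N x)%:E)%E \is a fin_num.
  rewrite ge0_fin_numE//; apply: le_lt_trans Bfin.
  by rewrite BE leeDl.
have NP : (\int[mu]_x (N x)%:E <= \int[mu]_x (P x)%:E)%E.
  by move: BG; rewrite GE BE leeD2rE.
rewrite integralE.
have posle : (\int[mu]_x (P x)%:E <= \int[mu]_x (fun x => (H x)%:E)^\+ x)%E.
  apply: ge0_le_integral_raw => x _; first by rewrite lee_fin.
  rewrite funeposE -EFin_max lee_fin /P ge_max !le_max lexx orbT andbT.
  by rewrite GBH.
have negle : (\int[mu]_x (fun x => (H x)%:E)^\- x <= \int[mu]_x (N x)%:E)%E.
  apply: ge0_le_integral_raw => x _; first exact: funeneg_ge0.
  rewrite funenegE -EFinN -EFin_max lee_fin /N ge_max !le_max lexx orbT andbT.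
  by have := GBH x => h; apply/orP; left; lra.
have negfin : (\int[mu]_x (fun x => (H x)%:E)^\- x)%E \is a fin_num.
  rewrite ge0_fin_numE; last by apply: integral_ge0 => x _; exact: funeneg_ge0.
  by apply: le_lt_trans negle _; rewrite -ge0_fin_numE.
by rewrite sube_ge0 ?negfin//; exact: le_trans negle (le_trans NP posle).
Qed.

Lemma hoelder_squares (a b : T -> R) (n : nat) : (3 <= n)%N ->
  measurable_fun [set: T] a -> measurable_fun [set: T] b -> (forall x, 0 <= a x) ->
  (\int[mu]_x (a x ^+ 2 * b x ^+ 2)%:E <=
   (\int[mu]_x (a x ^+ n)%:E) `^ (n%:R / 2)^-1
   * (\int[mu]_x (`|b x| `^ (2 * n%:R / (n%:R - 2)))%:E) `^ ((n%:R - 2) / n%:R))%E.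
Proof.
move=> n3 ma mb a0.
have n0 : 0 < n%:R :> R by rewrite ltr0n; exact: leq_trans n3.
have n2 : 0 < n%:R - 2 :> R by rewrite subr_gt0 ltr_nat.
have := @hoelder _ _ _ mu (fun x => a x ^+ 2) (fun x => b x ^+ 2) (n%:R / 2) (n%:R / (n%:R - 2))
  (measurable_funX _ ma) (measurable_funX _ mb).
rewrite divr_gt0// divr_gt0// !invf_div => /(_ isT isT) H.
have {}H := H _.
have /H {}H : 2 / n%:R + (n%:R - 2) / n%:R = 1 :> R.
  by rewrite -mulrDl addrC subrK divff// gt_eqF.
move: H; rewrite Lnorm1 unlock !invf_div.
rewrite (@eq_integral _ _ _ mu _ (fun x => (a x ^+ 2 * b x ^+ 2)%:E)); last first.
  by move=> x _; rewrite /= ger0_norm// mulr_ge0// sqr_ge0.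
move=> /le_trans; apply.
rewrite le_eqVlt; apply/orP; left; apply/eqP.
apply: f_equal2; [apply: (f_equal (fun z => z `^ _)%E)|apply: (f_equal (fun z => z `^ _)%E)].
- apply: eq_integral => x _; rewrite abse_EFin poweR_EFin ger0_norm ?sqr_ge0//.
  rewrite -!powR_mulrn// -powRrM; congr ((_ `^ _)%:E).
  by rewrite mulrC divfK// pnatr_eq0.
- apply: eq_integral => x _; rewrite abse_EFin poweR_EFin.
  rewrite normrX -powR_mulrn// -powRrM; congr ((_ `^ _)%:E).
  by rewrite mulrA.
Qed.

End integral_comparison.

(** * Stability *)

Section assembly.
Context {R : realType} {n : nat} (M : orientedRiemannian R n)
  (dv : {measure set (borel M) -> \bar R}).

Lemma lipschitz_W012 (f : M -> R) : lipschitz f -> compactly_supported f -> W012 dv f (grad f).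
Proof.
move=> lf sf; split.
- apply: cont_measurableR; first exact: openT.
  by move=> p _; exact: lipschitz_continuous lf p.
- by apply: measurable_grad; exact: lipschitz_continuous.
- exists (fun=> f); split=> //.
    rewrite (_ : (fun k : nat => _) = cst 0%E); first exact: cvg_cst.
    apply/funext => k; under eq_integral do rewrite subrr expr0n /=.
    exact: integral0.
  rewrite (_ : (fun k : nat => _) = cst 0%E); first exact: cvg_cst.
  apply/funext => k; under eq_integral do rewrite subrr /inner !mul0mx mxE.
  exact: integral0.
Qed.

Lemma compactly_supported_integral (f : M -> R) (s : R) : is_volume dv -> 0 < s ->
  continuous f -> compactly_supported f -> (\int[dv]_p (`|f p| `^ s)%:E < +oo)%E.
Proof.
move=> hdv s0 cf sf; have [W [oW KW Wfin]] := compact_finite_volume hdv sf.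
have /compact_bounded/ex_strict_bound_gt0[k k0 /= hk] : compact (f @` closure [set p | f p != 0]).
  by apply: continuous_compact sf; exact: continuous_subspaceT.
have W0 p : ~ W p -> f p = 0.
  move=> nW; apply/eqP/negPn/negP => fp; apply: nW; apply: KW.
  exact: subset_closure.
apply: (@le_lt_trans _ _ (\int[dv]_p (((cst (k `^ s)%:E : borel M -> \bar R) \_ W) p))%E).
  apply: ge0_le_integral_raw => p _; first by rewrite lee_fin powR_ge0.
  rewrite /patch; case: ifPn => [_|/negP nO]; last first.
    by rewrite W0 ?normr0 ?powR0 ?gt_eqF// => Op; apply: nO; rewrite inE.
  rewrite lee_fin; apply: ge0_ler_powR; rewrite ?nnegrE//; [exact: ltW|exact: ltW|].
  have [->|fp] := eqVneq (f p) 0; first by rewrite normr0 ltW.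
  by apply/ltW/hk; exists p => //; exact: subset_closure.
rewrite -integral_mkcond integral_cst; last exact: open_bor.
by apply: lte_mul_pinfty => //; rewrite lee_fin powR_ge0.
Qed.

End assembly.

(** The integrand of the second variation is bounded below by
    [|grad f|^2 - |A|^2 f^2], whose integral is nonnegative by the inequalities
    of Hoelder and Sobolev. *)
Theorem theorem5p2 (R : realType) (n : nat) (hn : (3 <= n)%N)
    (N : orientedRiemannian R (n + 1)) (K : R) (hK : K <= 0)
    (hN : sectional_le N K)
    (M : orientedRiemannian R n) (dv : {measure set (borel M) -> \bar R})
    (hdv : is_volume dv)
    (psi : M -> N) (hpsi : isometric_immersion psi)
    (hM : complete_manifold M) (hmin : minimal psi)
    (Cs : R) (hCs0 : 0 < Cs) (hCs : sobolev_constant dv Cs)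
    (hA : (\int[dv]_p (normA psi p ^+ n)%:E
             <= ((1 / Cs) `^ (n%:R / 2))%:E)%E) :
  stable psi dv.
Proof.
move=> f lf sf; have cf := lipschitz_continuous lf.
have n0 : 0 < n%:R :> R by rewrite ltr0n; exact: leq_trans hn.
have n2 : 0 < n%:R - 2 :> R by rewrite subr_gt0 ltr_nat.
have mf : measurable_fun [set: borel M] (f : borel M -> R).
  by apply: cont_measurableR => [|p _]; [exact: openT|exact: cf].
have mA : measurable_fun [set: borel M] (normA psi : borel M -> R).
  apply: cont_measurableR => [|p _]; first exact: openT.
  exact: (normA_continuous hpsi.1).
pose G (p : M) := inner p (grad f p) (grad f p).
pose S := ((\int[dv]_p (`|f p| `^ (2 * n%:R / (n%:R - 2)))%:E) `^ ((n%:R - 2) / n%:R))%E.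
have S0 : (0 <= S)%E by exact: poweR_ge0.
have sob : (S <= Cs%:E * \int[dv]_p (G p)%:E)%E by exact: hCs (lipschitz_W012 dv lf sf).
have Sfin : (S < +oo)%E.
  apply: poweR_lty; apply: compactly_supported_integral => //.
  by rewrite divr_gt0// mulr_gt0.
have hoe : (\int[dv]_p (normA psi p ^+ 2 * f p ^+ 2)%:E <= (1 / Cs)%:E * S)%E.
  apply: le_trans (hoelder_squares dv hn mA mf _) _ => [p|]; first exact: sqrtr_ge0.
  apply: lee_wpmul2r => //.
  have -> : (1 / Cs)%:E = (((1 / Cs) `^ (n%:R / 2))%:E `^ (n%:R / 2)^-1)%E.
    by rewrite poweR_EFin -powRrM mulfV ?powRr1 ?divr_ge0 ?ltW// gt_eqF// divr_gt0.
  apply: gt0_ler_poweR => //.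
  - rewrite in_itv /= leey andbT; apply: integral_ge0 => p _.
    by rewrite lee_fin exprn_ge0// sqrtr_ge0.
  - by rewrite in_itv /= leey andbT lee_fin powR_ge0.
apply: (@integral_ge0_of_le _ _ _ dv G (fun p => normA psi p ^+ 2 * f p ^+ 2)).
- exact: measurable_grad_norm.
- by apply: measurable_funM; exact: measurable_funX.
- by move=> p; exact: inner_ge0.
- by move=> p; rewrite mulr_ge0// sqr_ge0.
- move=> p; rewrite lerD2l lerN2 mulrDl gerDr.
  by rewrite mulr_le0_ge0// ?sqr_ge0//; exact: ricci_le0 hK hN.
- apply: le_trans hoe _.
  apply: (@le_trans _ _ ((1 / Cs)%:E * (Cs%:E * \int[dv]_p (G p)%:E))%E).
    by apply: lee_wpmul2l => //; rewrite lee_fin divr_ge0// ltW.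
  by rewrite muleA -EFinM divfK ?gt_eqF// mul1e.
- apply: le_lt_trans hoe _; apply: lte_mul_pinfty => //.
  by rewrite lee_fin divr_ge0// ltW.
Qed.
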